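(* Let $n\geq 3$ and let $B_1\subset\mathbf{R}^n$ be the open unit ball centered at the origin. There exists a positive constant $k(n)$, depending only on $n$, such that the following holds. Assume that $\vec b\in L^n(B_1)$ is a vector field $B_1\to\mathbf{R}^n$ and that $u\in H^1(B_1)$ is a weak solution of $$\begin{cases}-\Delta u(x)+\vec b(x)\cdot\nabla u(x)\geq 0 & \text{in } B_1,\\ u(x)\geq 0 & \text{on }\partial B_1.\end{cases}$$ If $\|\vec b\|_{L^n(B_1)}\leq k(n)$, then $u(x)\geq 0$ in $B_1$.
   Context: The inequality $-\Delta u+\vec b\cdot\nabla u\geq0$ in $B_1$ holds in the weak sense if $\int_{B_1}\nabla u\cdot\nabla\varphi\,dx+\int_{B_1}(\vec b\cdot\nabla u)\varphi\,dx\geq 0$ for all nonnegative $\varphi\in C_0^\infty(B_1)$ (equivalently, by density, for all nonnegative $\varphi\in H_0^1(B_1)$). The condition $u\geq0$ on $\partial B_1$ is in the trace sense, i.e. $u^-=-\min\{u,0\}\in H_0^1(B_1)$. The inequality $u\ge0$ in $B_1$ is understood almost everywhere. *)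

(* Defs.v *)
From HB Require Import structures.
From mathcomp Require Import all_boot all_order all_algebra.
From mathcomp Require Import all_classical all_reals all_analysis.
Import Order.TTheory GRing.Theory Num.Theory.
Import numFieldNormedType.Exports.

Set Implicit Arguments.
Unset Strict Implicit.
Unset Printing Implicit Defensive.

Local Open Scope classical_set_scope.
Local Open Scope ring_scope.

Definition rowvec_display : measure_display.
Proof. exact: default_measure_display. Qed.

(* 'rV[R]_n carries the product sigma-algebra (the one generated by the
   coordinates), as the library does for n.-tuple; it is the Borel
   sigma-algebra of R^n. *)
Section measurable_rowvec.
Context {R : realType} (n : nat).

Let coord (i : 'I_n) (x : 'rV[R]_n) : measurableTypeR R := x ord0 i.

Let rV_set0 : g_sigma_preimage coord set0.
Proof. exact: sigma_algebra0. Qed.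

Let rV_setC A : g_sigma_preimage coord A -> g_sigma_preimage coord (~` A).
Proof. exact: sigma_algebraC. Qed.

Let rV_bigcup (F : _^nat) : (forall i, g_sigma_preimage coord (F i)) ->
  g_sigma_preimage coord (\bigcup_i (F i)).
Proof. exact: sigma_algebra_bigcup. Qed.

HB.instance Definition _ := @isMeasurable.Build rowvec_display
  'rV[R]_n (g_sigma_preimage coord) rV_set0 rV_setC rV_bigcup.

End measurable_rowvec.

Section lebesgue_measure_rowvec.
Context {R : realType}.

Lemma measurable_coord n (i : 'I_n) :
  measurable_fun [set: 'rV[R]_n] (fun x => x ord0 i : measurableTypeR R).
Proof.
move=> _ Y mY; rewrite setTI; apply: sub_sigma_algebra => /=.
rewrite -bigcup_seq/=; exists i => /=; first by rewrite mem_index_enum.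
by exists Y => //; rewrite setTI.
Qed.

Lemma measurable_fun_rowvec d (T : measurableType d) n (f : T -> 'rV[R]_n) :
  (forall i, measurable_fun setT (fun x => f x ord0 i : measurableTypeR R)) ->
  measurable_fun setT f.
Proof.
move=> mf.
pose coord (i : 'I_n) (x : 'rV[R]_n) : measurableTypeR R := x ord0 i.
suff sub : g_sigma_preimage (fun i => coord i \o f) `<=` measurable.
  by move=> _ A mA; rewrite setTI; apply: sub; rewrite g_sigma_preimage_comp;
     exists A => //; rewrite setTI.
apply: smallest_sub; first exact: sigma_algebra_measurable.
move=> A; rewrite -bigcup_seq => -[i _ [B mB <-]].
exact: mf.
Qed.

Definition rV_cons n (p : measurableTypeR R * 'rV[R]_n) : 'rV[R]_n.+1 :=
  row_mx (const_mx p.1 : 'rV[R]_1) p.2.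

Definition rV_uncons n (v : 'rV[R]_n.+1) : measurableTypeR R * 'rV[R]_n :=
  (v ord0 ord0, @rsubmx R 1 1 n v).

Lemma rV_consK n : cancel (@rV_cons n) (@rV_uncons n).
Proof.
case=> a v; rewrite /rV_uncons /rV_cons /= row_mxKr; congr pair.
have -> : ord0 = lshift n (ord0 : 'I_1) by exact: val_inj.
by rewrite (@row_mxEl _ 1 1 n) mxE.
Qed.

Lemma measurable_rV_cons n : measurable_fun setT (@rV_cons n).
Proof.
apply: measurable_fun_rowvec => i; rewrite /rV_cons.
case: (@split_ordP 1 n i) => j ->.
- under eq_fun do rewrite (@row_mxEl _ 1 1 n) mxE.
  exact: measurable_fst.
- under eq_fun do rewrite (@row_mxEr _ 1 1 n).
  exact: (measurableT_comp (measurable_coord j) measurable_snd).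
Qed.

Lemma measurable_rV_uncons n : measurable_fun setT (@rV_uncons n).
Proof.
apply/measurable_fun_pairP; split => /=.
- exact: measurable_coord.
- apply: measurable_fun_rowvec => i /=.
  under eq_fun do rewrite mxE.
  exact: measurable_coord.
Qed.

Section step.
Variables (n : nat) (mu : {sigma_finite_measure set 'rV[R]_n -> \bar R}).

Definition lebesgue_rV_step : set 'rV[R]_n.+1 -> \bar R :=
  pushforward (@lebesgue_measure R \x mu)%E (@rV_cons n).

Let step0 : lebesgue_rV_step set0 = 0%E.
Proof. by rewrite /lebesgue_rV_step /pushforward preimage_set0 measure0. Qed.

Let step_ge0 A : (0 <= lebesgue_rV_step A)%E.
Proof. by rewrite /lebesgue_rV_step /pushforward measure_ge0. Qed.

Let step_preimage A : measurable A -> measurable (@rV_cons n @^-1` A).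
Proof. by move=> mA; rewrite -[X in measurable X]setTI; exact: measurable_rV_cons. Qed.

Let step_sigma_additive : semi_sigma_additive lebesgue_rV_step.
Proof.
move=> F mF tF mUF; rewrite /lebesgue_rV_step /pushforward preimage_bigcup.
apply: measure_semi_sigma_additive.
- by move=> k; exact: step_preimage.
- apply/trivIsetP => /= i j _ _ ij; rewrite -preimage_setI.
  by move/trivIsetP : tF => /(_ _ _ _ _ ij) ->//; rewrite preimage_set0.
- by rewrite -preimage_bigcup; exact: step_preimage.
Qed.

HB.instance Definition _ := isMeasure.Build _ _ _ lebesgue_rV_step
  step0 step_ge0 step_sigma_additive.

Let step_sigma_finite : sigma_finite setT lebesgue_rV_step.
Proof.
have /sigma_finiteP[F [TF ndF Foo]] := sigma_finiteT (@lebesgue_measure R).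
have /sigma_finiteP[G [TG ndG Goo]] := sigma_finiteT mu.
exists (fun k => @rV_uncons n @^-1` (F k `*` G k)).
  rewrite -preimage_bigcup (_ : \bigcup_k (F k `*` G k) = setT) ?preimage_setT//.
  rewrite -setXTT TF TG predeqE => -[x y]; split.
    by move=> [k _ []/= ? ?]; split; exists k.
  move=> [/= [i _ Fix] [j _ Gjy]]; exists (maxn i j) => //; split.
    by move: x Fix; exact/subsetPset/ndF/leq_maxl.
  by move: y Gjy; exact/subsetPset/ndG/leq_maxr.
move=> k; have [mFk Fk] := Foo k; have [mGk Gk] := Goo k.
have mFG : measurable (F k `*` G k) by exact: measurableX.
split; first by rewrite -[X in measurable X]setTI; exact: measurable_rV_uncons.
rewrite /lebesgue_rV_step /pushforward -comp_preimage.
rewrite (_ : _ \o _ = id); last by apply/funext => x /=; rewrite rV_consK.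
by rewrite preimage_id product_measure1E// lte_mul_pinfty// ge0_fin_numE.
Qed.

HB.instance Definition _ := Measure_isSigmaFinite.Build _ _ _ lebesgue_rV_step
  step_sigma_finite.

End step.

Fixpoint lebesgue_rV (n : nat) : {sigma_finite_measure set 'rV[R]_n -> \bar R} :=
  if n is m.+1 then lebesgue_rV_step (lebesgue_rV m)
  else \d_(0 : 'rV[R]_0).
End lebesgue_measure_rowvec.

Section euclidean.
Context {R : realType} {n : nat}.
Implicit Types x y : 'rV[R]_n.

Definition dotv x y : R := \sum_(i < n) x ord0 i * y ord0 i.

(* The library's norm on 'rV[R]_n is the sup norm; it induces the same topology. *)
Definition enorm x : R := Num.sqrt (dotv x x).

Definition unit_ball : set 'rV[R]_n := [set x | enorm x < 1].

End euclidean.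
Arguments unit_ball : clear implicits.

Section test_functions.
Context {R : realType} {n : nat}.
Implicit Types (phi : 'rV[R]_n -> R) (Omega : set 'rV[R]_n).

Definition partial (i : 'I_n) phi : 'rV[R]_n -> R :=
  'D_(delta_mx ord0 i) phi.

Definition iter_partial (s : seq 'I_n) phi : 'rV[R]_n -> R :=
  foldr partial phi s.

Definition smooth phi :=
  forall s : seq 'I_n, continuous (iter_partial s phi) /\
    forall i x, derivable (iter_partial s phi) x (delta_mx ord0 i).

Definition gradient phi (x : 'rV[R]_n) : 'rV[R]_n := \row_i partial i phi x.

(* Elements of C_0^oo(Omega), extended by 0 outside Omega. *)
Definition test_function Omega phi :=
  let supp := closure [set x | phi x != 0] in
  [/\ smooth phi, compact supp & supp `<=` Omega].

End test_functions.

(* As usual, elements of the function spaces below are represented by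
   functions defined everywhere, whose values outside Omega are irrelevant. *)
Section function_spaces.
Context {R : realType} {n : nat}.
Notation leb := (@lebesgue_rV R n).
Implicit Types (u : 'rV[R]_n -> R) (b g : 'rV[R]_n -> 'rV[R]_n).
Implicit Types (Omega : set 'rV[R]_n) (p : R).

Definition Lp_norm Omega p u : \bar R := 'N[leb]_(p%:E)[EFin \o (u \_ Omega)]%E.

Definition in_Lp Omega p u :=
  measurable_fun Omega u /\ (Lp_norm Omega p u < +oo)%E.

Definition in_Lp_vec Omega p b :=
  measurable_fun Omega b /\ (Lp_norm Omega p (enorm \o b) < +oo)%E.

Definition is_weak_gradient Omega u g :=
  in_Lp_vec Omega 2 g /\
  forall phi, test_function Omega phi -> forall i,
    \int[leb]_(x in Omega) (u x * partial i phi x) =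
    - \int[leb]_(x in Omega) (g x ord0 i * phi x).

Definition in_H1 Omega u :=
  in_Lp Omega 2 u /\ exists g, is_weak_gradient Omega u g.

(* The weak gradient of an H^1 function, which is unique up to a null set. *)
Definition weak_gradient Omega u : 'rV[R]_n -> 'rV[R]_n :=
  get [set g | is_weak_gradient Omega u g].

(* Closure of C_0^oo(Omega) in H^1(Omega). *)
Definition in_H10 Omega u :=
  in_H1 Omega u /\
  exists phi : nat -> 'rV[R]_n -> R,
    [/\ forall k, test_function Omega (phi k),
        Lp_norm Omega 2 (u \- phi k) @[k --> \oo] --> 0%E &
        Lp_norm Omega 2
          (fun x => enorm (weak_gradient Omega u x - gradient (phi k) x))
          @[k --> \oo] --> 0%E].

(* -Delta u + b . grad u >= 0 in Omega, in the weak sense *)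
Definition weak_supersolution Omega b u :=
  forall phi, test_function Omega phi -> (forall x, 0 <= phi x) ->
    0 <= \int[leb]_(x in Omega) dotv (weak_gradient Omega u x) (gradient phi x)
       + \int[leb]_(x in Omega) (dotv (b x) (weak_gradient Omega u x) * phi x).

(* u >= 0 on the boundary of Omega, in the trace sense *)
Definition boundary_nonneg Omega u :=
  in_H10 Omega (fun x => - Num.min (u x) 0).

End function_spaces.

(* Main.v *)
(* Test the inequality with the negative part w of u. Where w > 0 one has
   grad u = - grad w, so, with H = |grad w| on {w > 0} and H = 0 elsewhere,
     int H^2 <= int |b| H w <= |b|_n |H|_2 |w|_(2n/(n-2)) <= S |b|_n |H|_2^2
   by Hoelder's and Sobolev's inequalities; if |b|_n is small then H = 0, and
   Sobolev's inequality gives w = 0. Replacing w by F(w), where F is a smooth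
   approximation of |t| with F(0) = F'(0) = 0, produces nonnegative test
   functions and makes it unnecessary to know that grad w = 0 on {w = 0}.
   Sobolev's inequality comes from the Gagliardo-Nirenberg inequality
   |f|_(n/(n-1)) <= |grad f|_1 applied to a power of f. *)

Require Import Defs.
From HB Require Import structures.
From mathcomp Require Import all_boot all_order all_algebra.
From mathcomp Require Import all_classical all_reals all_analysis.
From mathcomp Require Import measurable_realfun ring lra.
Import Order.TTheory GRing.Theory Num.Theory.
Import numFieldNormedType.Exports.

Set Implicit Arguments.
Unset Strict Implicit.
Unset Printing Implicit Defensive.

Local Open Scope classical_set_scope.
Local Open Scope ring_scope.

(** * Smooth functions and test functions *)

Section chain_rule.
Context {R : realType} {V : normedModType R}.
Implicit Types (f : V -> R) (x v : V).

Lemma is_derive_line f x v df :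
  is_derive x v f df <-> is_derive (0 : R) (1 : R) (fun h : R => f (h *: v + x)) df.
Proof.
have E : (fun h : R => h^-1 *: ((f \o shift x) (h *: v) - f x)) =
    (fun h : R => h^-1 *: (((fun h : R => f (h *: v + x)) \o shift 0) (h *: (1 : R))
       - f (0 *: v + x))).
  apply/funext => h /=; congr (_ *: (f (_ + _) - f _)).
    by rewrite addr0 /GRing.scale/= mulr1.
  by rewrite scale0r add0r.
split=> -[df1 df2]; split.
- by move: df1; rewrite /derivable E.
- by rewrite -df2 /derive E.
- by rewrite /derivable E.
- by rewrite -df2 /derive E.
Qed.

Lemma is_derive_chain (F : R -> R) f x v a df :
  is_derive (f x) (1 : R) F a -> is_derive x v f df ->
  is_derive x v (fun y => F (f y)) (a * df).
Proof.
move=> dF /is_derive_line df'; apply/is_derive_line.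
apply: (@is_derive1_comp _ F (fun h : R => f (h *: v + x))) => //.
by rewrite scale0r add0r.
Qed.

End chain_rule.

Section smooth_closure.
Context {R : realType} {n : nat}.
Implicit Types (f g : 'rV[R]_n -> R).

Lemma is_derive_partial f i x : derivable f x (delta_mx ord0 i) ->
  is_derive x (delta_mx ord0 i) f (partial i f x).
Proof. exact: derivableP. Qed.

Lemma partialE f i x df : is_derive x (delta_mx ord0 i) f df ->
  partial i f x = df.
Proof. by case. Qed.

Fixpoint Ck m f : Prop := if m is m'.+1 then
    continuous f /\ forall i, (forall x, derivable f x (delta_mx ord0 i)) /\
      Ck m' (partial i f)
  else continuous f.

Lemma CkW m f : Ck m.+1 f -> Ck m f.
Proof.
elim: m f => [f []//|m IH f [cf df]]; split => // i.
by have [dfi Ci] := df i; split => //; exact: IH.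
Qed.

Lemma smooth_partial f i : smooth f -> smooth (partial i f).
Proof.
move=> sf s; have := sf (rcons s i).
by rewrite /iter_partial -cats1 foldr_cat.
Qed.

Lemma smoothP f : smooth f <-> forall m, Ck m f.
Proof.
split=> [sf m|Cf s].
  elim: m f sf => [f /(_ [::])[]//|m IH f sf].
  have [cf df] := sf [::]; split => // i; split; first exact: df.
  exact/IH/smooth_partial.
elim/last_ind: s f Cf => [f Cf|s i IH f Cf].
  by split; [exact: (Cf 0%N)|move=> i x; have [_ /(_ i)[]] := Cf 1%N].
rewrite /iter_partial -cats1 foldr_cat /=; apply: IH => m.
by have [_ /(_ i)[]] := Cf m.+1.
Qed.

Lemma smooth_continuous f : smooth f -> continuous f.
Proof. by move=> /(_ [::])[]. Qed.

Lemma smooth_derivable f i x : smooth f -> derivable f x (delta_mx ord0 i).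
Proof. by move=> /(_ [::])[]. Qed.

Lemma Ck_cst m (c : R) : Ck m (fun=> c).
Proof.
elim: m c => [c|m IH c]; first exact: cst_continuous.
split; first exact: cst_continuous.
move=> i; split; first by move=> x; exact: derivable_cst.
rewrite (_ : partial i _ = fun=> 0)//; apply/funext => x.
by apply: partialE; exact: is_derive_cst.
Qed.

Lemma CkD m f g : Ck m f -> Ck m g -> Ck m (fun x => f x + g x).
Proof.
elim: m f g => [f g /= cf cg x|m IH f g [cf df] [cg dg]].
  exact: continuousD (cf x) (cg x).
split; first by move=> x; exact: continuousD (cf x) (cg x).
move=> i; have [dfi Cfi] := df i; have [dgi Cgi] := dg i.
have D x := is_deriveD (is_derive_partial (dfi x)) (is_derive_partial (dgi x)).
split; first by move=> x; case: (D x).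
rewrite (_ : partial i _ = fun x => partial i f x + partial i g x); first exact: IH.
by apply/funext => x; exact: partialE.
Qed.

Lemma CkM m f g : Ck m f -> Ck m g -> Ck m (fun x => f x * g x).
Proof.
elim: m f g => [f g /= cf cg x|m IH f g Cf Cg].
  exact: continuousM (cf x) (cg x).
have [cf df] := Cf; have [cg dg] := Cg.
split; first by move=> x; exact: continuousM (cf x) (cg x).
move=> i; have [dfi Cfi] := df i; have [dgi Cgi] := dg i.
have D x := is_deriveM (is_derive_partial (dfi x)) (is_derive_partial (dgi x)).
split; first by move=> x; case: (D x).
rewrite (_ : partial i _ =
    fun x => f x * partial i g x + g x * partial i f x).
  by apply: CkD; apply: IH => //; exact: CkW.
by apply/funext => x; exact: partialE.
Qed.

Lemma Ck_chain m (F F' : R -> R) f :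
  (forall x, is_derive (f x) (1 : R) F (F' (f x))) ->
  Ck m.+1 f -> Ck m (fun x => F' (f x)) -> Ck m.+1 (fun x => F (f x)).
Proof.
move=> dF [cf df] CF'; split.
  move=> x; apply: (@continuous_comp _ _ _ f F); first exact: cf.
  apply: differentiable_continuous; apply/derivable1_diffP.
  by case: (dF x).
move=> i; have [dfi Cfi] := df i.
have D x := is_derive_chain (dF x) (is_derive_partial (dfi x)).
split; first by move=> x; case: (D x).
rewrite (_ : partial i _ = fun x => F' (f x) * partial i f x); first exact: CkM.
by apply/funext => x; exact: partialE.
Qed.

Lemma Ck_comp0 (F F' : R -> R) f :
  (forall x, is_derive (f x) (1 : R) F (F' (f x))) ->
  Ck 0 f -> Ck 0 (fun x => F (f x)).
Proof.
move=> dF /= cf x; apply: (@continuous_comp _ _ _ f F); first exact: cf.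
apply: differentiable_continuous; apply/derivable1_diffP.
by case: (dF x).
Qed.

Lemma Ck_expR m f : Ck m f -> Ck m (fun x => expR (f x)).
Proof.
elim: m f => [f|m IH f] Cf.
  by apply: (@Ck_comp0 _ expR) => // x; exact: is_derive_expR.
by apply: (@Ck_chain _ _ expR) => //; exact/IH/CkW.
Qed.

Lemma is_derive_inv (t : R) : t != 0 ->
  is_derive t 1 (fun y : R => y^-1) (-1 * (t^-1 * t^-1)).
Proof.
move=> t0; have H := @is_deriveV _ id t 1 1 t0 (is_derive_id _ _).
by apply: is_derive_eq H _; rewrite /= -exprVn /GRing.scale/=; ring.
Qed.

Lemma CkV m f : (forall x, f x != 0) -> Ck m f -> Ck m (fun x => (f x)^-1).
Proof.
move=> f0; have D x := is_derive_inv (f0 x).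
elim: m => [|m IH] Cf; first exact: (@Ck_comp0 _ (fun t => -1 * (t^-1 * t^-1))).
apply: (@Ck_chain _ (fun y => y^-1) (fun t => -1 * (t^-1 * t^-1))) => //; have CV := IH (CkW Cf).
exact: (CkM (Ck_cst m (-1)) (CkM CV CV)).
Qed.

Lemma Ck_sqrt m f : (forall x, 0 < f x) -> Ck m f ->
  Ck m (fun x => Num.sqrt (f x)).
Proof.
move=> f0; have D x := is_derive1_sqrt (f0 x).
elim: m => [|m IH] Cf.
  exact: (@Ck_comp0 _ (fun t => (2 * Num.sqrt t)^-1)).
apply: (@Ck_chain _ _ (fun t => (2 * Num.sqrt t)^-1)) => //.
apply: CkV; first by move=> x; rewrite mulf_neq0// gt_eqF// sqrtr_gt0.
exact: (CkM (Ck_cst m 2) (IH (CkW Cf))).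
Qed.

Lemma is_derive_coord (i j : 'I_n) (x : 'rV[R]_n) :
  is_derive x (delta_mx ord0 i) (fun y : 'rV[R]_n => y ord0 j) (i == j)%:R.
Proof.
apply/is_derive_line.
rewrite (_ : (fun h : R => _) = (fun h : R => (i == j)%:R * h + x ord0 j)); last first.
  by apply/funext => h; rewrite !mxE eqxx /= eq_sym mulrC.
have := is_deriveD (is_deriveZ (i == j)%:R (is_derive_id (0 : R) (1 : R)))
  (is_derive_cst (x ord0 j) (0 : R) (1 : R)).
by move=> H; apply: is_derive_eq H _; rewrite addr0 /GRing.scale/= mulr1.
Qed.

Lemma Ck_coord m j : Ck m (fun x : 'rV[R]_n => x ord0 j).
Proof.
have c : continuous (fun x : 'rV[R]_n => x ord0 j) by exact: coord_continuous.
case: m => [//|m]; split => // i.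
split; first by move=> x; case: (is_derive_coord i j x).
rewrite (_ : partial i _ = fun=> (i == j)%:R); first exact: Ck_cst.
by apply/funext => x; apply: partialE; exact: is_derive_coord.
Qed.

Lemma smooth_cst (c : R) : smooth (fun _ : 'rV[R]_n => c).
Proof. by apply/smoothP => m; exact: Ck_cst. Qed.

Lemma smoothM f g : smooth f -> smooth g -> smooth (fun x => f x * g x).
Proof.
by move=> /smoothP Cf /smoothP Cg; apply/smoothP => m; exact: CkM.
Qed.

Lemma smooth_prod (I : Type) (s : seq I) (f : I -> 'rV[R]_n -> R) :
  (forall i, smooth (f i)) -> smooth (fun x => \prod_(i <- s) f i x).
Proof.
move=> sf; elim: s => [|i s IH].
  by under eq_fun do rewrite big_nil; exact: smooth_cst.
by under eq_fun do rewrite big_cons; exact: smoothM.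
Qed.

Lemma partialM f g i x : smooth f -> smooth g ->
  partial i (fun x => f x * g x) x = f x * partial i g x + g x * partial i f x.
Proof.
move=> sf sg; apply: partialE.
by apply: is_deriveM; apply: is_derive_partial; exact: smooth_derivable.
Qed.

Lemma partial_chain (F : R -> R) f i x a : smooth f ->
  is_derive (f x) (1 : R) F a ->
  partial i (fun x => F (f x)) x = a * partial i f x.
Proof.
move=> sf dF; apply: partialE; apply: is_derive_chain dF _.
by apply: is_derive_partial; exact: smooth_derivable.
Qed.

End smooth_closure.

Section test_function_theory.
Context {R : realType} {n : nat}.
Variable Omega : set 'rV[R]_n.
Implicit Types (f g : 'rV[R]_n -> R).

Lemma test_smooth f : test_function Omega f -> smooth f.
Proof. by case. Qed.

Lemma test_function_sub f g : test_function Omega f -> smooth g ->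
  (forall x, f x = 0 -> g x = 0) -> test_function Omega g.
Proof.
move=> [sf cf fO] sg fg.
have sub : [set x | g x != 0] `<=` [set x | f x != 0].
  by move=> x /=; apply: contra_neq => /fg.
have sub' : closure [set x | g x != 0] `<=` closure [set x | f x != 0].
  exact: closure_subset.
split => //; last exact: subset_trans fO.
by apply: subclosed_compact cf _ => //; exact: closed_closure.
Qed.

Lemma test_function_eq0 f x : test_function Omega f -> ~ Omega x -> f x = 0.
Proof.
move=> [_ _ fO] Ox; apply: contra_notP Ox => /eqP fx.
by apply: fO; apply: subset_closure.
Qed.

Lemma test_function_partial f i : test_function Omega f ->
  test_function Omega (partial i f).
Proof.
move=> [sf cf fO].
have sub : [set x | partial i f x != 0] `<=` closure [set x | f x != 0].
  move=> x /=; apply: contra_neqP => xS.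
  have : nbhs x (~` closure [set x | f x != 0]).
    by apply: open_nbhs_nbhs; split => //; apply: closed_openC; exact: closed_closure.
  move=> xN; rewrite /partial (@near_eq_derive _ _ _ _ (cst 0)).
  - by rewrite derive_cst.
  - apply: filterS xN => y /= yS; apply: contra_notP yS => /eqP fy.
    exact: subset_closure.
have sub' : closure [set x | partial i f x != 0] `<=` closure [set x | f x != 0].
  rewrite [X in _ `<=` X](_ : _ = closure (closure [set x | f x != 0])).
    exact: closure_subset.
  by apply/closure_id; exact: closed_closure.
split; first exact: smooth_partial.
- by apply: subclosed_compact cf _ => //; exact: closed_closure.
- exact: subset_trans fO.
Qed.

Lemma test_function_bounded f : test_function Omega f ->
  exists2 M, 0 < M & forall x, `|f x| <= M.
Proof.
move=> tf; have [sf cf fO] := tf.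
have [[x0 fx0]|fz] := pselect (exists x, f x != 0); last first.
  exists 1 => // x; suff -> : f x = 0 by rewrite normr0.
  by apply: contra_notP fz => /eqP fx; exists x.
have [c _ cM] : exists2 c, c \in closure [set x | f x != 0] &
    forall t, t \in closure [set x | f x != 0] -> `|f t| <= `|f c|.
  apply: EVT_max_rV => //.
    by exists x0; exact: subset_closure.
  apply: continuous_subspaceT => x.
  apply: (@continuous_comp _ _ _ f Num.norm); first exact: smooth_continuous.
  exact: norm_continuous.
exists (`|f c| + 1) => [|x]; first by rewrite ltr_wpDl.
have [fx|fx] := eqVneq (f x) 0; first by rewrite fx normr0 addr_ge0.
rewrite ler_wpDr//; apply: cM; rewrite inE; exact: subset_closure.
Qed.

End test_function_theory.

(** * Borel sets of R^n *)

Section borel_rowvec.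
Context {R : realType} {n : nat}.

Let cell (qk : 'rV[rat]_n * nat) : set 'rV[R]_n :=
  [set y | forall i, `|y ord0 i - ratr (qk.1 ord0 i)| < qk.2.+1%:R^-1].

Let measurable_cell qk : measurable (cell qk).
Proof.
rewrite (_ : cell qk = \bigcap_(i in [set: 'I_n])
    [set y : 'rV[R]_n | `|y ord0 i - ratr (qk.1 ord0 i)| < qk.2.+1%:R^-1]).
  apply: fin_bigcap_measurable => // i _.
  have mi : measurable_fun [set: 'rV[R]_n]
      (fun y => `|y ord0 i - ratr (qk.1 ord0 i)| : measurableTypeR R).
    apply: measurableT_comp => //; apply: measurable_funB => //.
    exact: measurable_coord.
  have := mi measurableT _ (measurable_itv `]-oo, qk.2.+1%:R^-1[).
  rewrite setTI; congr measurable; apply/seteqP; split => y /=;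
    by rewrite in_itv.
by apply/seteqP; split => y /= yc i; [move=> _; exact: yc|exact: yc].
Qed.

Lemma open_rowvec_measurable (U : set 'rV[R]_n) : open U -> measurable U.
Proof.
move=> oU.
rewrite (_ : U = \bigcup_(qk in [set: 'rV[rat]_n * nat])
    if `[< cell qk `<=` U >] then cell qk else set0); last first.
  apply/seteqP; split => [x Ux|x [qk _]]; last first.
    by case: ifPn => // /asboolP qkU; exact: qkU.
  have /nbhs_ballP[e /= e0 xe] : nbhs x U by exact: open_nbhs_nbhs.
  have [k ke] : exists k : nat, k.+1%:R^-1 < e / 2.
    have e20 : 0 < e / 2 by rewrite divr_gt0.
    have /(_ _ _ e20) := @cvgr0_norm_lt _ _ _ _ _ _ (@cvg_harmonic R).
    by move=> [k _ /(_ k (leqnn k))]; rewrite ger0_norm//= => ke; exists k.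
  have hk : (0 : R) < k.+1%:R^-1 by rewrite invr_gt0.
  have ex_q i : exists q : rat, `|x ord0 i - ratr q| < k.+1%:R^-1.
    have lt : x ord0 i - k.+1%:R^-1 < x ord0 i + k.+1%:R^-1.
      by rewrite ltrD2l; apply: lt_trans hk; rewrite oppr_lt0.
    have [q] := rat_in_itvoo lt; rewrite in_itv/= => /andP[q1 q2].
    exists q; rewrite ltr_norml.
    by move: (k.+1%:R^-1) q1 q2 => r q1 q2; apply/andP; split; lra.
  have [q qP] := choice ex_q.
  pose qk := (\row_i q i, k).
  have cx : cell qk x by move=> i; rewrite mxE; exact: qP.
  exists qk => //; case: ifPn => // /asboolPn; apply: contra_notP => _.
  move=> y cy; apply: xe; split => // i j; rewrite ord1 -ball_normE/=.
  rewrite -[X in `|X|](subrKA (ratr (q j))).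
  apply: le_lt_trans (ler_normD _ _) _; rewrite [e]splitr.
  have := cy j; rewrite mxE /= distrC => cyj.
  by apply: ltrD; apply: lt_trans ke.
apply: countable_bigcupT_measurable => // qk.
by case: ifPn => // _; exact: measurable_cell.
Qed.

Lemma continuous_rowvec_measurable (f : 'rV[R]_n -> R) :
  continuous f -> measurable_fun setT (f : 'rV[R]_n -> measurableTypeR R).
Proof.
move=> /continuousP cf; apply: (measurability _ (RGenOpens.measurableE R)).
move=> _ [_ [a [b ->] <-]]; rewrite setTI; apply: open_rowvec_measurable.
exact/cf/interval_open.
Qed.

End borel_rowvec.

(** * Hoelder's inequality for several functions *)

Section weighted_amgm.
Context {R : realType} {I : eqType}.
Implicit Types (s : seq I) (p : I -> R).

Lemma prod_powR_le_expR s p (a : I -> R) :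
  (forall i, 0 <= p i) -> (forall i, 0 <= a i) ->
  \prod_(i <- s) a i `^ p i <= expR (\sum_(i <- s) p i * (a i - 1)).
Proof.
move=> p0 a0; elim: s => [|i s IH]; first by rewrite !big_nil expR0.
rewrite !big_cons expRD ler_pM ?powR_ge0//.
  by apply: prodr_ge0 => j _; exact: powR_ge0.
rewrite mulrC expRM ge0_ler_powR ?nnegrE ?expR_ge0//.
by apply: le_trans (expR_ge1Dx _); lra.
Qed.

Lemma powR_sum s p (c : R) : c != 0 ->
  c `^ (\sum_(i <- s) p i) = \prod_(i <- s) c `^ p i.
Proof.
move=> c0; elim: s => [|i s IH]; first by rewrite !big_nil powRr0.
by rewrite !big_cons powRD ?c0 ?implybT// IH.
Qed.

Lemma prod_powR_le_sum s p (a : I -> R) :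
  (forall i, 0 <= p i) -> \sum_(i <- s) p i = 1 -> (forall i, 0 <= a i) ->
  \prod_(i <- s) a i `^ p i <= \sum_(i <- s) p i * a i.
Proof.
move=> p0 p1 a0; set A := (leRHS).
have A0 : 0 <= A by apply: sumr_ge0 => i _; rewrite mulr_ge0.
have scale c : 0 < c -> \prod_(i <- s) a i `^ p i <= c * expR (A / c - 1).
  move=> c0.
  have -> : \prod_(i <- s) a i `^ p i = c * \prod_(i <- s) (a i / c) `^ p i.
    have -> : c * \prod_(i <- s) (a i / c) `^ p i =
        \prod_(i <- s) c `^ p i * \prod_(i <- s) (a i / c) `^ p i.
      by rewrite -powR_sum ?p1 ?powRr1 ?ltW// lt0r_neq0.
    rewrite -big_split/=; apply: eq_bigr => i _.
    by rewrite -powRM ?divr_ge0 ?(ltW c0)// mulrC divfK// gt_eqF.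
  rewrite ler_pM2l//.
  apply: le_trans (prod_powR_le_expR _ _ _) _ => //.
    by move=> i; rewrite divr_ge0// (ltW c0).
  rewrite ler_expR le_eqVlt; apply/orP; left; apply/eqP.
  rewrite -[X in _ = _ - X]p1 /A mulr_suml -sumrB; apply: eq_bigr => i _.
  by rewrite mulrBr mulr1 mulrA.
move: A0; rewrite le_eqVlt => /predU1P[A0|A0]; last first.
  by have := scale _ A0; rewrite divff ?gt_eqF// subrr expR0 mulr1.
rewrite -A0; apply/ler_addgt0Pr => e e0; rewrite add0r.
apply: le_trans (scale _ e0) _; rewrite -A0 mul0r sub0r.
by rewrite -[leRHS]mulr1 ler_pM2l// -expR0 ler_expR; lra.
Qed.

Local Open Scope ereal_scope.

Lemma prod_poweR_le_sum s p (a : I -> \bar R) :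
  (forall i, (0 <= p i)%R) -> (\sum_(i <- s) p i = 1)%R -> (forall i, 0 <= a i) ->
  \prod_(i <- s) a i `^ p i <= \sum_(i <- s) (p i)%:E * a i.
Proof.
move=> p0 p1 a0.
have [/hasP[i si /andP[pi0 /eqP ai]]|/hasPn fin] :=
    boolP (has (fun i => (0 < p i)%R && (a i == +oo)) s).
  rewrite [leRHS](big_rem i)//= ai gt0_muley ?lte_fin// addye ?leey//.
  rewrite gt_eqF// (@lt_le_trans _ _ 0)//.
  by apply: sume_ge0 => j _; rewrite mule_ge0 ?lee_fin.
have E i : i \in s ->
    a i `^ p i = ((fine (a i)) `^ p i)%:E /\
    (p i)%:E * a i = (p i * fine (a i))%:E.
  move=> /fin; rewrite negb_and -leNgt => /orP[pi|ai].
    have -> : p i = 0%R by apply/eqP; rewrite eq_le pi p0.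
    by rewrite poweRe0 powRr0 mul0e mul0r.
  by have := a0 i; move: ai; case: (a i).
rewrite (eq_big_seq (fun i => ((fine (a i)) `^ p i)%:E)); last first.
  by move=> i /E[].
rewrite [leRHS](eq_big_seq (fun i => (p i * fine (a i))%:E)); last first.
  by move=> i /E[].
rewrite prodEFin sumEFin lee_fin prod_powR_le_sum// => i.
by rewrite fine_ge0.
Qed.

End weighted_amgm.

Section hoelder_prod.
Context d (T : measurableType d) {R : realType} {I : eqType}.
Variables (mu : {measure set T -> \bar R}).
Implicit Types (s : seq I) (p : I -> R).
Local Open Scope ereal_scope.

Lemma prode_ge0 s (a : I -> \bar R) :
  (forall i, 0 <= a i) -> 0 <= \prod_(i <- s) a i.
Proof.
by move=> a0; elim: s => [|i s IH]; rewrite ?big_nil ?big_cons ?mule_ge0.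
Qed.

Lemma emeasurable_prod s (f : I -> T -> \bar R) :
  (forall i, measurable_fun setT (f i)) ->
  measurable_fun setT (fun x => \prod_(i <- s) f i x).
Proof.
move=> mf; elim: s => [|i s IH].
  by under eq_fun do rewrite big_nil; exact: measurable_cst.
by under eq_fun do rewrite big_cons; exact: emeasurable_funM.
Qed.

Lemma emeasurable_prod_poweR s p (f : I -> T -> \bar R) :
  (forall i, measurable_fun setT (f i)) ->
  measurable_fun setT (fun x => \prod_(i <- s) f i x `^ p i).
Proof.
move=> mf; apply: emeasurable_prod => i.
exact: (measurableT_comp (measurable_poweR _)).
Qed.

Lemma hoelder_prod s p (f : I -> T -> \bar R) :
  (forall i, (0 <= p i)%R) -> (\sum_(i <- s) p i = 1)%R ->
  (forall i, measurable_fun setT (f i)) -> (forall i x, 0 <= f i x) ->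
  \int[mu]_x \prod_(i <- s) f i x `^ p i <=
  \prod_(i <- s) (\int[mu]_x f i x) `^ p i.
Proof.
move=> p0 p1 mf f0.
have I0 i : 0 <= \int[mu]_x f i x by exact: integral_ge0.
have mprod := emeasurable_prod_poweR s p mf.
have [/hasP[i si /andP[pi0 /eqP Ii]]|/hasPn nz] :=
    boolP (has (fun i => (0 < p i)%R && (\int[mu]_x f i x == 0)) s).
  rewrite [leLHS](_ : _ = 0); first by apply: prode_ge0 => j; exact: poweR_ge0.
  have /ae_eq_integral_abs : \int[mu]_x `|f i x| = 0.
    by rewrite -[RHS]Ii; apply: eq_integral => x _; rewrite gee0_abs.
  move=> /(_ measurableT (mf i)) fi0.
  rewrite -(integral0 mu setT); apply: ae_eq_integral => //.
  apply: filterS fi0 => x /(_ Logic.I) /= fi0 _.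
  by rewrite (big_rem i)//= fi0 poweR0r ?mul0e// gt_eqF.
have [/hasP[i si /andP[pi0 /eqP Ii]]|/hasPn fin] :=
    boolP (has (fun i => (0 < p i)%R && (\int[mu]_x f i x == +oo)) s).
  rewrite [leRHS](big_rem i)//= Ii poweRyr ?gt_eqF// gt0_mulye ?leey//.
  have : {subset rem i s <= s} by exact: mem_rem.
  elim: (rem i s) => [|j r IH] rs; first by rewrite big_nil lte01.
  rewrite big_cons mule_gt0//; last first.
    by apply: IH => k kr; apply: rs; rewrite inE kr orbT.
  have := nz _ (rs j (mem_head _ _)); rewrite negb_and -leNgt => /orP[pj|Ij].
    have -> : p j = 0%R by apply/eqP; rewrite eq_le pj p0.
    by rewrite poweRe0 lte01.
  by rewrite poweR_gt0// lt0e Ij I0.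
pose c i := if (0 < p i)%R && (i \in s) then fine (\int[mu]_x f i x) else 1%R.
have cE i : i \in s -> (0 < p i)%R -> (c i)%:E = \int[mu]_x f i x.
  move=> si pi; rewrite /c pi si/=; have := fin _ si; rewrite pi/= => Iy.
  by rewrite fineK// ge0_fin_numE// ltey.
have c0 i : (0 < c i)%R.
  rewrite /c; case: ifPn => // /andP[pi si].
  by rewrite -lte_fin -/(c i); have := cE _ si pi; rewrite /c pi si => ->;
     have := nz _ si; rewrite pi/= lt0e => ->; rewrite I0.
have f'0 i x : 0 <= (c i)^-1%:E * f i x.
  by rewrite mule_ge0// lee_fin invr_ge0 ltW.
have fE x : \prod_(i <- s) f i x `^ p i =
    (\prod_(i <- s) c i `^ p i)%:E * \prod_(i <- s) ((c i)^-1%:E * f i x) `^ p i.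
  rewrite -prodEFin -big_split/=; apply: eq_bigr => i _.
  rewrite -poweR_EFin -poweRM ?f'0 ?lee_fin ?(ltW (c0 i))//.
  by rewrite muleA -EFinM divff ?mul1e// gt_eqF.
have RE : \prod_(i <- s) (\int[mu]_x f i x) `^ p i =
    (\prod_(i <- s) c i `^ p i)%:E.
  rewrite -prodEFin; apply: eq_big_seq => i si.
  have := p0 i; rewrite le_eqVlt => /predU1P[<-|pi].
    by rewrite poweRe0 powRr0.
  by rewrite -(cE i si pi) poweR_EFin.
have mf' i : measurable_fun setT (fun x => (c i)^-1%:E * f i x).
  exact: measurable_funeM.
rewrite (eq_integral (fun x => (\prod_(i <- s) c i `^ p i)%:E *
  \prod_(i <- s) ((c i)^-1%:E * f i x) `^ p i)); last by move=> x _; exact: fE.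
rewrite ge0_integralZl//; first last.
- by rewrite lee_fin; apply: prodr_ge0 => i _; exact: powR_ge0.
- by move=> x _; apply: prode_ge0 => i; exact: poweR_ge0.
- exact: emeasurable_prod_poweR.
rewrite RE -[leRHS]mule1 lee_pmul2l//; last first.
  by rewrite lte_fin; apply: prodr_gt0 => i _; exact: powR_gt0.
apply: (@le_trans _ _
    (\int[mu]_x \sum_(i <- s) (p i)%:E * ((c i)^-1%:E * f i x))).
  apply: ge0_le_integral => //.
  - by move=> x _; apply: prode_ge0 => i; exact: poweR_ge0.
  - exact: emeasurable_prod_poweR.
  - by apply: emeasurable_sum => i; exact: measurable_funeM.
  - by move=> x _; exact: prod_poweR_le_sum.
rewrite ge0_integral_sum//; first last.
- by move=> i x _; rewrite mule_ge0// lee_fin.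
- by move=> i; exact: measurable_funeM.
rewrite -p1 -sumEFin.
rewrite le_eqVlt; apply/orP; left; apply/eqP; apply: eq_big_seq => i si.
rewrite ge0_integralZl// ?lee_fin// ge0_integralZl//; last first.
  by rewrite lee_fin invr_ge0 ltW.
have := p0 i; rewrite le_eqVlt => /predU1P[<-|pi]; first by rewrite mul0e.
by rewrite -(cE i si pi) -EFinM mulVf ?mulr1// gt_eqF.
Qed.

End hoelder_prod.

(** * The Gagliardo-Nirenberg inequality *)

Section grid_lines.
Context {R : realType}.
Local Open Scope ereal_scope.
Notation leb1 := (@lebesgue_measure R).

Lemma rV_cons0 n (p : measurableTypeR R * 'rV[R]_n) :
  rV_cons p ord0 ord0 = p.1.
Proof. by have /(congr1 fst) := rV_consK p. Qed.

Lemma rV_consS n (p : measurableTypeR R * 'rV[R]_n) (i : 'I_n) :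
  rV_cons p ord0 (lift ord0 i) = p.2 ord0 i.
Proof.
rewrite /rV_cons (_ : lift ord0 i = rshift 1 i); last exact: val_inj.
by rewrite (@row_mxEr _ 1 1 n).
Qed.

Definition upd n (i : 'I_n) (t : R) (x : 'rV[R]_n) : 'rV[R]_n :=
  \row_j (if j == i then t else x ord0 j).

Lemma upd_cons0 n t (p : measurableTypeR R * 'rV[R]_n) :
  upd ord0 t (rV_cons p) = rV_cons (t, p.2).
Proof.
apply/rowP => j; rewrite mxE; case: (unliftP ord0 j) => [k|] ->.
  by rewrite !rV_consS.
by rewrite eqxx rV_cons0.
Qed.

Lemma upd_consS n i t (p : measurableTypeR R * 'rV[R]_n) :
  upd (lift ord0 i) t (rV_cons p) = rV_cons (p.1, upd i t p.2).
Proof.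
apply/rowP => j; rewrite mxE; case: (unliftP ord0 j) => [k|] ->.
  by rewrite !rV_consS mxE (inj_eq lift_inj).
by rewrite !rV_cons0.
Qed.

Lemma measurable_upd n (i : 'I_n) :
  measurable_fun setT (fun p : measurableTypeR R * 'rV[R]_n => upd i p.1 p.2).
Proof.
apply: measurable_fun_rowvec => j; under eq_fun do rewrite mxE.
case: eqP => _; first exact: measurable_fst.
exact: (measurableT_comp (measurable_coord j) measurable_snd).
Qed.

Definition line_integral n (i : 'I_n) (f : 'rV[R]_n -> \bar R) x :=
  \int[leb1]_t f (upd i t x).

Lemma line_integral_ge0 n (i : 'I_n) f x :
  (forall x, 0 <= f x) -> 0 <= line_integral i f x.
Proof. by move=> f0; apply: integral_ge0 => t _. Qed.

Lemma measurable_line_integral n (i : 'I_n) (f : 'rV[R]_n -> \bar R) :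
  measurable_fun setT f -> (forall x, 0 <= f x) ->
  measurable_fun setT (line_integral i f).
Proof.
move=> mf f0.
apply: (@measurable_fun_fubini_tonelli_G _ _ _ _ _ leb1
  (fun p : measurableTypeR R * 'rV[R]_n => f (upd i p.1 p.2))) => //.
exact: (measurableT_comp mf (measurable_upd i)).
Qed.

Lemma lebesgue_rV_fubini n (f : 'rV[R]_n.+1 -> \bar R) :
  measurable_fun setT f -> (forall x, 0 <= f x) ->
  \int[lebesgue_rV n.+1]_x f x =
  \int[lebesgue_rV n]_y \int[leb1]_t f (rV_cons (t, y)).
Proof.
move=> mf f0.
have mfc : measurable_fun setT (f \o @rV_cons R n).
  exact: (measurableT_comp mf (@measurable_rV_cons R n)).
rewrite [LHS](_ : _ = \int[leb1 \x lebesgue_rV n]_p (f \o @rV_cons R n) p).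
  by rewrite -(fubini_tonelli2 (f \o @rV_cons R n)) //=; move=> p; exact: f0.
transitivity (\int[pushforward (leb1 \x lebesgue_rV n) (@rV_cons R n)]_x f x).
  by [].
rewrite ge0_integral_pushforward//.
exact: measurable_rV_cons.
Qed.

Lemma poweRD_ge0 (x : \bar R) (r s : R) : (0 <= r)%R -> (0 <= s)%R ->
  x `^ (r + s) = x `^ r * x `^ s.
Proof.
move=> r0 s0; have [rs0|rs0] := eqVneq (r + s)%R 0%R; last first.
  by rewrite poweRD// add_neq0_poweRD_def.
have [-> ->] : r = 0%R /\ s = 0%R by split; lra.
by rewrite addr0 poweRe0 mule1.
Qed.

(* The induction step applies Hoelder's inequality in the variable [x_0]. *)
Lemma grid_inequality n (p : R) (f : 'rV[R]_n -> \bar R) :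
  (0 <= p)%R -> ((n%:R - 1) * p <= 1)%R ->
  measurable_fun setT f -> (forall x, 0 <= f x) ->
  \int[lebesgue_rV n]_x
    (f x `^ (1 - (n%:R - 1) * p) * \prod_(i < n) line_integral i f x `^ p) <=
  (\int[lebesgue_rV n]_x f x) `^ (1 + p).
Proof.
elim: n f => [|n IH] f p0 np mf f0.
  rewrite /= !integral_dirac//; last first.
    under eq_fun do rewrite big_ord0 mule1.
    exact: (measurableT_comp (measurable_poweR _)).
  by rewrite big_ord0 mule1 diracT !mul1e (_ : 1 - _ = 1 + p)%R//; ring.
have np' : (0 <= 1 - n%:R * p)%R.
  by move: np; rewrite -natr1 addrK; lra.
have -> : (1 - (n.+1%:R - 1) * p = 1 - n%:R * p)%R by rewrite -natr1 addrK.
have mli i := measurable_line_integral i mf f0.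
have mpow (q : R) d (T : measurableType d) (g : T -> \bar R) :
    measurable_fun setT g -> measurable_fun setT (fun x => g x `^ q).
  by move=> mg; exact: (measurableT_comp (measurable_poweR _)).
have mcons : measurable_fun setT
    (fun z : measurableTypeR R * 'rV[R]_n => f (rV_cons z)).
  exact: (measurableT_comp mf (@measurable_rV_cons R n)).
rewrite lebesgue_rV_fubini//; first last.
- move=> x; rewrite mule_ge0 ?poweR_ge0// prode_ge0// => i.
  exact: poweR_ge0.
- apply: emeasurable_funM; first exact: mpow.
  by apply: emeasurable_prod => i; exact: mpow.
rewrite [in leRHS]lebesgue_rV_fubini//.
set F := fun y => \int[leb1]_t f (rV_cons (t, y)).
have F0 y : 0 <= F y by apply: integral_ge0.
have mF : measurable_fun setT F.
  exact: (@measurable_fun_fubini_tonelli_G _ _ _ _ _ leb1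
    (fun z : measurableTypeR R * 'rV[R]_n => f (rV_cons z))).
have pn : ((n%:R - 1) * p <= 1)%R by lra.
apply: le_trans (IH F p0 pn mF F0).
have mH : measurable_fun setT (fun z : measurableTypeR R * 'rV[R]_n =>
    f (rV_cons z) `^ (1 - n%:R * p) *
    \prod_(i < n.+1) line_integral i f (rV_cons z) `^ p).
  apply: emeasurable_funM; first exact: mpow.
  apply: emeasurable_prod => i; apply: mpow.
  exact: (measurableT_comp (mli i) (@measurable_rV_cons R n)).
apply: ge0_le_integral => //.
- move=> y _; apply: integral_ge0 => t _.
  rewrite mule_ge0 ?poweR_ge0// prode_ge0// => i; exact: poweR_ge0.
- apply: (@measurable_fun_fubini_tonelli_G _ _ _ _ _ leb1 _ mH) => z.
  rewrite mule_ge0 ?poweR_ge0// prode_ge0// => i; exact: poweR_ge0.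
- apply: emeasurable_funM; first exact: mpow.
  by apply: emeasurable_prod => i; apply: mpow; exact: measurable_line_integral.
move=> y _.
have mft : measurable_fun setT (fun t : measurableTypeR R => f (rV_cons (t, y))).
  exact: (measurableT_comp mcons (measurable_pair2 y)).
pose g (o : option 'I_n) (t : R) : \bar R :=
  if o is Some i then line_integral i (fun y => f (rV_cons (t, y))) y
  else f (rV_cons (t, y)).
pose q (o : option 'I_n) : R := if o is Some _ then p else (1 - n%:R * p)%R.
pose s : seq (option 'I_n) := None :: [seq Some i | i <- index_enum 'I_n].
have mts (i : 'I_n) : measurable_fun setT
    (fun ts : measurableTypeR R * measurableTypeR R => f (rV_cons (ts.1, upd i ts.2 y))).
  apply: (measurableT_comp mcons); apply/measurable_fun_pairP; split => /=.
    exact: measurable_fst.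
  apply: measurable_fun_rowvec => j; under eq_fun do rewrite /= mxE.
  by case: eqP => _; [exact: measurable_snd|exact: measurable_cst].
have gE (i : 'I_n) : \int[leb1]_t g (Some i) t = line_integral i F y.
  rewrite /g /line_integral /F.
  exact: (fubini_tonelli (fun ts : measurableTypeR R * measurableTypeR R =>
    f (rV_cons (ts.1, upd i ts.2 y)))).
have lhsE t : f (rV_cons (t, y)) `^ (1 - n%:R * p) *
    \prod_(i < n.+1) line_integral i f (rV_cons (t, y)) `^ p =
    F y `^ p * \prod_(o <- s) g o t `^ q o.
  rewrite big_cons big_map big_ord_recl /=.
  rewrite muleCA; congr (_ * (_ * _)).
    by congr (_ `^ p); rewrite /line_integral /F; apply: eq_integral => r _; rewrite upd_cons0.
  apply: eq_bigr => i _; congr (_ `^ p).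
  by rewrite /line_integral; apply: eq_integral => r _; rewrite upd_consS.
have mg o : measurable_fun setT (g o : measurableTypeR R -> \bar R).
  case: o => [i|] //=.
  exact: (@measurable_fun_fubini_tonelli_F _ _ _ _ _ leb1
    (fun ts : measurableTypeR R * measurableTypeR R => f (rV_cons (ts.1, upd i ts.2 y)))).
have g0 o t : 0 <= g o t.
  by case: o => [i|] /=; [exact: line_integral_ge0|exact: f0].
rewrite [leLHS](_ : _ =
    \int[leb1]_t (F y `^ p * \prod_(o <- s) g o t `^ q o)); last first.
  by apply: eq_integral => t _; exact: lhsE.
rewrite ge0_integralZl//; first last.
- exact: poweR_ge0.
- by move=> t _; apply: prode_ge0 => o; exact: poweR_ge0.
- exact: emeasurable_prod_poweR.
have q0 o : (0 <= q o)%R by case: o.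
have q1 : (\sum_(o <- s) q o = 1)%R.
  rewrite big_cons big_map /= sumr_const card_ord -mulr_natl; ring.
have FE : F y `^ p * F y `^ (1 - n%:R * p) = F y `^ (1 - (n%:R - 1) * p).
  rewrite -(poweRD_ge0 (F y) p0 np'); congr (_ `^ _); ring.
have prodE : \prod_(o <- s) (\int[leb1]_t g o t) `^ q o =
    F y `^ (1 - n%:R * p) * \prod_(i < n) line_integral i F y `^ p.
  rewrite /s big_cons big_map; congr (_ * _).
  by apply: eq_bigr => i _; rewrite gE.
rewrite -FE -muleA -prodE; apply: lee_wpmul2l; first exact: poweR_ge0.
exact: (hoelder_prod leb1 q0 q1 mg g0).
Qed.

Lemma gagliardo n (f : 'rV[R]_n -> \bar R) : (1 < n)%N ->
  measurable_fun setT f -> (forall x, 0 <= f x) ->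
  \int[lebesgue_rV n]_x \prod_(i < n) line_integral i f x `^ (n%:R - 1)^-1 <=
  (\int[lebesgue_rV n]_x f x) `^ (n%:R / (n%:R - 1)).
Proof.
move=> n1 mf f0.
have n10 : (0 < n%:R - 1 :> R)%R by rewrite subr_gt0 ltr1n.
have := @grid_inequality n (n%:R - 1)^-1 f.
rewrite divff ?gt_eqF// subrr invr_ge0 ltW// => /(_ isT (lexx _) mf f0).
under eq_integral do rewrite poweRe0 mul1e.
by rewrite (_ : 1 + _ = n%:R / (n%:R - 1))%R//; field; rewrite gt_eqF.
Qed.

End grid_lines.

(** * Limits of integrals and powers *)

Section real_dominated_convergence.
Context d (T : measurableType d) {R : realType} (mu : {measure set T -> \bar R}).
Variables (D : set T) (mD : measurable D).
Variables (f_ : (T -> R)^nat) (f g : T -> R).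
Hypothesis mf_ : forall n, measurable_fun D (f_ n).
Hypothesis mf : measurable_fun D f.
Hypothesis f_f : {ae mu, forall x, D x -> f_ ^~ x @ \oo --> f x}.
Hypothesis ig : mu.-integrable D (EFin \o g).
Hypothesis f_g : {ae mu, forall x, D x -> forall n, `|f_ n x| <= g x}.

Lemma real_dominated_cvg :
  (fun n => \int[mu]_(x in D) (f_ n x)%:E)%E @ \oo -->
  (\int[mu]_(x in D) (f x)%:E)%E.
Proof.
have [||||//] := @dominated_convergence _ _ _ mu D mD (fun n => EFin \o f_ n)
  (EFin \o f) (EFin \o g) _ _ _ ig.
- by move=> n; exact/measurable_EFinP.
- exact/measurable_EFinP.
- apply: filterS f_f => x fx Dx; apply: cvg_EFin; first exact: nearW.
  exact: fx.
- by apply: filterS f_g => x fx n Dx; rewrite lee_fin; exact: fx.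
Qed.

Lemma real_dominated_integrable : mu.-integrable D (EFin \o f).
Proof.
have [||||//] := @dominated_convergence _ _ _ mu D mD (fun n => EFin \o f_ n)
  (EFin \o f) (EFin \o g) _ _ _ ig.
- by move=> n; exact/measurable_EFinP.
- exact/measurable_EFinP.
- apply: filterS f_f => x fx Dx; apply: cvg_EFin; first exact: nearW.
  exact: fx.
- by apply: filterS f_g => x fx n Dx; rewrite lee_fin; exact: fx.
Qed.

Lemma Rintegral_dominated_cvg :
  (fun n => \int[mu]_(x in D) f_ n x) @ \oo --> \int[mu]_(x in D) f x.
Proof.
have fi := integrable_fin_num mD real_dominated_integrable.
by have := real_dominated_cvg; rewrite -(fineK fi) => /fine_cvgP[].
Qed.

Lemma real_dominated : mu.-integrable D (EFin \o f) /\
  (fun n => \int[mu]_(x in D) f_ n x) @ \oo --> \int[mu]_(x in D) f x.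
Proof. by split; [exact: real_dominated_integrable|exact: Rintegral_dominated_cvg]. Qed.

End real_dominated_convergence.

Lemma fatou_le d (T : measurableType d) (R : realType)
    (mu : {measure set T -> \bar R}) (D : set T) (f_ : (T -> R)^nat) (f : T -> R)
    (K : \bar R) :
  measurable D -> (forall n, measurable_fun D (f_ n)) ->
  (forall n x, D x -> 0 <= f_ n x) ->
  (forall x, D x -> f_ ^~ x @ \oo --> f x) ->
  (forall n, \int[mu]_(x in D) (f_ n x)%:E <= K)%E ->
  (\int[mu]_(x in D) (f x)%:E <= K)%E.
Proof.
move=> mD mf_ f0 ff fK.
have -> : (\int[mu]_(x in D) (f x)%:E =
    \int[mu]_(x in D) limn_einf (fun n => (f_ n x)%:E))%E.
  apply: eq_integral => x /[!inE] Dx; apply/esym.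
  have : (fun n => (f_ n x)%:E) @ \oo --> (f x)%:E.
    by apply: cvg_EFin; [exact: nearW|exact: ff].
  by move=> /cvg_limn_einf_sup[].
apply: le_trans (@fatou _ _ _ mu D mD (fun n x => (f_ n x)%:E) _ _) _.
- by move=> n; exact/measurable_EFinP.
- by move=> n x Dx; rewrite lee_fin; exact: f0.
apply: le_trans (limn_einf_sup _) _; rewrite limn_esup_lim.
apply: lime_le; first exact: is_cvg_esups.
apply: nearW => m; apply: ge_ereal_sup => _ [k _ <-]; exact: fK.
Qed.

Lemma continuous_mulf (R : realType) (T : topologicalType) (f g : T -> R) :
  continuous f -> continuous g -> continuous (fun x => f x * g x).
Proof. by move=> cf cg x; exact: continuousM (cf x) (cg x). Qed.

Lemma continuous_addf (R : realType) (T : topologicalType) (f g : T -> R) :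
  continuous f -> continuous g -> continuous (fun x => f x + g x).
Proof. by move=> cf cg x; exact: continuousD (cf x) (cg x). Qed.

Lemma continuous_invf (R : realType) (T : topologicalType) (f : T -> R) :
  (forall x, f x != 0) -> continuous f -> continuous (fun x => (f x)^-1).
Proof. by move=> f0 cf x; exact: cvgV (f0 x) (cf x). Qed.

Lemma continuous_normf (R : realType) (T : topologicalType) (f : T -> R) :
  continuous f -> continuous (fun x => `|f x|).
Proof.
move=> cf x; apply: (@continuous_comp _ _ _ f Num.norm); first exact: cf.
exact: norm_continuous.
Qed.

Section powR_limits.
Context {R : realType}.

Lemma cvg_powR (T : Type) (F : set_system T) (FF : Filter F) (u : T -> R)
    (x r : R) : 0 < r -> (forall k, 0 <= u k) -> 0 <= x ->
  u @ F --> x -> (fun k => u k `^ r) @ F --> x `^ r.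
Proof.
move=> r0 u0; rewrite le_eqVlt => /predU1P[x0|x0] ux.
  rewrite -x0 powR0 ?gt_eqF//; apply/cvgr0Pnorm_lt => e e0.
  have e0' : 0 < e `^ r^-1 by exact: powR_gt0.
  move: ux; rewrite -x0 => /cvgr0Pnorm_lt/(_ _ e0'); apply: filterS => k.
  rewrite (ger0_norm (u0 k)) (ger0_norm (powR_ge0 _ _)) => uk.
  rewrite -[ltRHS](powRr1 (ltW e0)) -(mulVf (lt0r_neq0 r0)) powRrM.
  by rewrite gt0_ltr_powR// ?nnegrE ?powR_ge0.
have c : {for x, continuous (fun t : R => t `^ r)}.
  apply: differentiable_continuous; apply/derivable1_diffP.
  by apply: derivable_powR; rewrite in_itv/= andbT.
exact: (cvg_comp _ _ ux c).
Qed.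

Lemma continuous_powRf (T : topologicalType) (f : T -> R) (r : R) : 0 < r ->
  (forall t, 0 <= f t) -> continuous f -> continuous (fun t => f t `^ r).
Proof. by move=> r0 f0 cf t; apply: cvg_powR => //; exact: cf. Qed.

End powR_limits.

Section powR_line.
Context {R : realType}.
Notation leb1 := (@lebesgue_measure R).

Lemma powR_line_bound (f f' : R -> R) (a b r : R) :
  a < b -> 1 < r -> (forall t, is_derive t (1:R) f (f' t)) -> continuous f' ->
  (forall t, 0 <= f t) -> f a = 0 ->
  ((f b `^ r)%:E <=
   \int[leb1]_(t in `[a, b]) (r * (f t `^ (r - 1) * `|f' t|))%:E)%E.
Proof.
move=> ab r1 df cf' f0 fa.
have r0 : 0 < r by exact: lt_trans r1.
have cf : continuous f.
  by move=> t; apply: differentiable_continuous; apply/derivable1_diffP; case: (df t).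
pose e (k : nat) : R := k.+1%:R^-1.
have e0 k : 0 < e k by rewrite invr_gt0.
have e1 k : e k <= 1 by rewrite invf_le1// ler1n.
have cvge : e @ \oo --> (0 : R) by exact: cvg_harmonic.
have fe0 k t : 0 < f t + e k by rewrite ltr_wpDl.
have dF k t : is_derive t (1:R) (fun t => (f t + e k) `^ r)
    (r * ((f t + e k) `^ (r - 1)) * f' t).
  have dfk : is_derive t (1:R) (fun t => f t + e k) (f' t).
    have := is_deriveD (df t) (is_derive_cst (e k) t (1:R)).
    by rewrite addr0.
  exact: (@is_derive1_comp R (@powR R ^~ r) (fun t => f t + e k) t _ _
    (is_derive1_powR r (fe0 k t)) dfk).
have cpow k s : continuous (fun t => (f t + e k) `^ s).
  move=> t; apply: (@continuous_comp _ _ _ (fun t => f t + e k) (fun y => y `^ s)).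
    by apply: continuous_addf => //; exact: cst_continuous.
  apply: differentiable_continuous; apply/derivable1_diffP.
  by apply: derivable_powR; rewrite in_itv/= andbT.
have cdF k : continuous (fun t => r * ((f t + e k) `^ (r - 1)) * f' t).
  apply: continuous_mulf => //; apply: continuous_mulf => //.
  exact: cst_continuous.
pose I_ k t := r * ((f t + e k) `^ (r - 1) * `|f' t|).
have cI k : continuous (I_ k).
  apply: continuous_mulf; first exact: cst_continuous.
  by apply: continuous_mulf => //; exact: continuous_normf.
have mab : measurable (`[a, b] : set (measurableTypeR R)) by exact: measurable_itv.
have mc (g : R -> R) : continuous g -> measurable_fun (`[a, b] : set (measurableTypeR R)) g.
  by move=> cg; apply: measurable_funTS; exact: continuous_measurable_fun.
have step k : ((f b `^ r)%:E <= (e k `^ r)%:E +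
    \int[leb1]_(t in `[a, b]) (I_ k t)%:E)%E.
  have fb : f b `^ r <= (f b + e k) `^ r.
    by rewrite ge0_ler_powR ?nnegrE ?(ltW r0)// ?(ltW (fe0 _ _))// lerDl ltW.
  apply: (@le_trans _ _ ((e k `^ r)%:E + ((f b + e k) `^ r - e k `^ r)%:E)%E).
    by rewrite -EFinD lee_fin addrC subrK.
  rewrite leeD2l// EFinB.
  have FTC := @continuous_FTC2 R (fun t => r * ((f t + e k) `^ (r - 1)) * f' t)
    (fun t => (f t + e k) `^ r) a b ab.
  rewrite fa add0r in FTC.
  rewrite -FTC.
  - apply: le_trans (le_trans (lee_abs _) (le_abse_integral _ _ _)) _ => //.
      by apply/measurable_EFinP; apply: mc; exact: cdF.
    rewrite le_eqVlt; apply/orP; left; apply/eqP; apply: eq_integral => t _ /=.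
    rewrite /I_ !normrM mulrA (ger0_norm (ltW r0)).
    by rewrite (ger0_norm (powR_ge0 _ _)).
  - exact: continuous_subspaceT (cdF k).
  - split.
    + by move=> t _; case: (dF k t).
    + by apply: cvg_at_right_filter; exact: cpow.
    + by apply: cvg_at_left_filter; exact: cpow.
  - by move=> t _; rewrite derive1E; case: (dF k t).
have icst (c : R) : leb1.-integrable `[a, b] (EFin \o (fun=> c)).
  apply: continuous_compact_integrable; first exact: segment_compact.
  by apply: continuous_subspaceT => t; exact: cst_continuous.
have DCT : (fun k => \int[leb1]_(t in `[a, b]) (I_ k t)%:E)%E @ \oo -->
    (\int[leb1]_(t in `[a, b]) (r * (f t `^ (r - 1) * `|f' t|))%:E)%E.
  apply: (@real_dominated_cvg _ _ _ leb1 _ mab I_ _ (I_ 0%N)) => //.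
  - by move=> k; exact: mc.
  - apply: measurable_funM => //; apply: measurable_funM.
      exact: (measurableT_comp (measurable_powR _) (mc _ cf)).
    by apply: measurableT_comp => //; exact: mc.
  - apply: nearW => t _; apply: cvgM; first exact: cvg_cst.
    apply: cvgM; last exact: cvg_cst.
    apply: cvg_powR => //; [by rewrite subr_gt0|by move=> k; exact: ltW|].
    rewrite -[X in _ --> X]addr0; apply: cvgD; first exact: cvg_cst.
    exact: cvge.
  - apply: continuous_compact_integrable; first exact: segment_compact.
    exact: continuous_subspaceT.
  - apply: nearW => t _ k; rewrite ger0_norm; last first.
      by rewrite !mulr_ge0// ?powR_ge0// ltW.
    rewrite /I_ ler_pM2l// ler_wpM2r// ge0_ler_powR ?nnegrE//.
    + by rewrite subr_ge0 ltW.
    + exact: ltW.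
    + exact: ltW.
    + by rewrite lerD2l lef_pV2 ?posrE// ler_nat.
have cvgR : (fun k => (e k `^ r)%:E + \int[leb1]_(t in `[a, b]) (I_ k t)%:E)%E @ \oo
    --> (\int[leb1]_(t in `[a, b]) (r * (f t `^ (r - 1) * `|f' t|))%:E)%E.
  rewrite -[X in _ --> X]add0e; apply: cvgeD => //.
  apply: cvg_EFin; first exact: nearW.
  rewrite -(powR0 (lt0r_neq0 r0)); apply: cvg_powR => // k.
  exact: ltW.
by apply: (cvge_to_ge cvgR); exact: nearW.
Qed.

End powR_line.

(** * Sobolev's inequality *)

Section enorm_theory.
Context {R : realType} {n : nat}.
Implicit Types x y : 'rV[R]_n.

Lemma dotv_ge0 x : 0 <= dotv x x.
Proof. by apply: sumr_ge0 => i _; rewrite -expr2 sqr_ge0. Qed.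

Lemma enorm_ge0 x : 0 <= enorm x.
Proof. exact: sqrtr_ge0. Qed.

Lemma sqr_enorm x : enorm x ^+ 2 = dotv x x.
Proof. by rewrite sqr_sqrtr// dotv_ge0. Qed.

Lemma ler_coord_enorm x i : `|x ord0 i| <= enorm x.
Proof.
rewrite -(ler_pXn2r (ltn0Sn 1)) ?nnegrE ?enorm_ge0// sqr_enorm.
rewrite /dotv (bigD1 i)//= real_normK ?num_real// expr2 lerDl.
by apply: sumr_ge0 => j _; rewrite -expr2 sqr_ge0.
Qed.

Lemma measurable_enorm : measurable_fun setT (@enorm R n).
Proof.
apply: (measurableT_comp (continuous_measurable_fun (@sqrt_continuous R))).
apply: measurable_sum => i; apply: measurable_funM; exact: measurable_coord.
Qed.

Lemma unit_ball_measurable : measurable (unit_ball R n).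
Proof.
have := measurable_enorm measurableT (measurable_itv `]-oo, (1 : R)[).
rewrite setTI; congr measurable; apply/seteqP; split => x /=;
  by rewrite /unit_ball/= in_itv.
Qed.

End enorm_theory.

Definition cube (R : realType) n : set 'rV[R]_n :=
  [set x : 'rV[R]_n | forall i, `|x ord0 i| <= 1].
Arguments cube : clear implicits.

Section cube.
Context {R : realType}.

Lemma measurable_cube n : measurable (cube R n).
Proof.
rewrite (_ : cube R n =
    \bigcap_(i in [set: 'I_n]) [set x : 'rV[R]_n | `|x ord0 i| <= 1]).
  apply: fin_bigcap_measurable => // i _.
  have := @measurable_coord R n i measurableT _ (measurable_itv `[(-1 : R), 1]).
  rewrite setTI; congr measurable; apply/seteqP; split => x /=;
    by rewrite in_itv/= ler_norml.
by apply/seteqP; split => x /= xC i; [move=> _; exact: xC|exact: xC].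
Qed.

Lemma lebesgue_cube_lty n : (lebesgue_rV n (cube R n) < +oo)%E.
Proof.
elim: n => [|n IH].
  by rewrite /= diracE; case: (_ \in _); rewrite ltry.
have E : @rV_cons R n @^-1` cube R n.+1 = `[(-1 : R), 1]%classic `*` cube R n.
  apply/seteqP; split => -[t y] /=.
    move=> tyC; split.
      by have := tyC ord0; rewrite rV_cons0 in_itv/= ler_norml.
    by move=> i; have := tyC (lift ord0 i); rewrite rV_consS.
  rewrite in_itv/= -ler_norml => -[t1 yC] i.
  by case: (unliftP ord0 i) => [j|] ->; rewrite ?rV_consS ?rV_cons0//=; exact: yC.
rewrite [X in (X < _)%E](_ : _ =
  (@lebesgue_measure R \x lebesgue_rV n)%E (@rV_cons R n @^-1` cube R n.+1))//.
rewrite E product_measure1E//; last exact: measurable_cube.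
apply: lte_mul_pinfty => //.
by rewrite /= lebesgue_measure_itv/=; case: ifP => // _; rewrite -EFinD.
Qed.

Lemma sub_unit_ball_cube n : unit_ball R n `<=` cube R n.
Proof. by move=> x xB i; apply: le_trans (ler_coord_enorm _ _) _; exact: ltW. Qed.

Lemma lebesgue_unit_ball_lty n : (@lebesgue_rV R n (unit_ball R n) < +oo)%E.
Proof.
apply: le_lt_trans (lebesgue_cube_lty n).
apply: le_measure; rewrite ?inE; [|exact: measurable_cube|].
- exact: unit_ball_measurable.
- exact: sub_unit_ball_cube.
Qed.

End cube.

Lemma lee_prod_ge0 (R : realType) (I : Type) (s : seq I) (a b : I -> \bar R) :
  (forall i, 0 <= a i)%E -> (forall i, a i <= b i)%E ->
  (\prod_(i <- s) a i <= \prod_(i <- s) b i)%E.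
Proof.
move=> a0 ab; elim: s => [|i s IH]; first by rewrite !big_nil.
rewrite !big_cons lee_pmul//.
by elim: s {IH} => [|j s IH]; rewrite ?big_nil ?big_cons ?mule_ge0.
Qed.

Section sobolev.
Context {R : realType} {n : nat}.
Implicit Types f : 'rV[R]_n -> R.
Notation leb := (@lebesgue_rV R n).
Notation ball := (unit_ball R n).

Lemma is_derive_upd f (i : 'I_n) t x : smooth f ->
  is_derive t (1 : R) (fun t => f (upd i t x)) (partial i f (upd i t x)).
Proof.
move=> sf; apply/is_derive_line.
rewrite (_ : (fun h : R => _) =
    fun h : R => f (h *: delta_mx ord0 i + upd i t x)).
  apply: (iffLR (is_derive_line f (upd i t x) (delta_mx ord0 i) _)).
  by apply: is_derive_partial; exact: smooth_derivable.
apply/funext => h; congr (f _); apply/rowP => j; rewrite !mxE eqxx /=.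
by case: eqP => _; rewrite /GRing.scale/= ?mulr1 ?mulr0 ?add0r.
Qed.

Lemma continuous_upd_smooth f (i : 'I_n) x : smooth f ->
  continuous (fun t => f (upd i t x)).
Proof.
move=> sf t; apply: differentiable_continuous; apply/derivable1_diffP.
by case: (is_derive_upd i t x sf).
Qed.

Lemma test_function_line_bound f (r : R) (i : 'I_n) x :
  test_function ball f -> (forall x, 0 <= f x) -> 1 < r ->
  ((f x `^ r)%:E <=
   line_integral i (fun y => (r * (f y `^ (r - 1) * `|partial i f y|))%:E) x)%E.
Proof.
move=> tf f0 r1; have sf := test_smooth tf.
have r0 : 0 < r by exact: lt_trans r1.
have F0 y : (0 <= (r * (f y `^ (r - 1) * `|partial i f y|))%:E)%E.
  by rewrite lee_fin !mulr_ge0// ?powR_ge0// ltW.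
have [fx|fx] := eqVneq (f x) 0.
  by rewrite fx powR0 ?gt_eqF//; exact: line_integral_ge0.
have xB : ball x.
  by apply: contrapT => /(test_function_eq0 tf) fx0; rewrite fx0 eqxx in fx.
have x1 : -1 < x ord0 i.
  suff : `|x ord0 i| < 1 by rewrite ltr_norml => /andP[].
  exact: le_lt_trans (ler_coord_enorm _ _) xB.
have xE : upd i (x ord0 i) x = x.
  by apply/rowP => j; rewrite mxE; case: eqP => [->|].
have fa : f (upd i (-1) x) = 0.
  apply: (test_function_eq0 tf) => /= uB.
  have := le_lt_trans (ler_coord_enorm _ i) uB.
  by rewrite mxE eqxx normrN1 ltxx.
have := @powR_line_bound R (fun t => f (upd i t x))
  (fun t => partial i f (upd i t x)) (-1) (x ord0 i) r x1 r1
  (fun t => is_derive_upd i t x sf)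
  (continuous_upd_smooth (i := i) (x := x) (smooth_partial i sf)) (fun t => f0 _) fa.
rewrite xE => /le_trans; apply.
apply: ge0_subset_integral => //.
apply/measurable_EFinP; apply: continuous_measurable_fun.
apply: continuous_mulf; first exact: cst_continuous.
apply: continuous_mulf; last first.
  by apply: continuous_normf; exact: continuous_upd_smooth (smooth_partial i sf).
apply: continuous_powRf; first by rewrite subr_gt0.
- by move=> t; exact: f0.
- exact: continuous_upd_smooth.
Qed.

Lemma measurable_smooth f : smooth f -> measurable_fun setT f.
Proof. by move=> sf; apply: continuous_rowvec_measurable; exact: smooth_continuous. Qed.

Lemma measurable_enorm_gradient f : smooth f ->
  measurable_fun setT (fun x => enorm (gradient f x)).
Proof.
move=> sf; apply: (measurableT_comp measurable_enorm).
apply: measurable_fun_rowvec => i; under eq_fun do rewrite mxE.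
exact: measurable_smooth (smooth_partial _ sf).
Qed.

Lemma sobolev f : (3 <= n)%N -> test_function ball f -> (forall x, 0 <= f x) ->
  ((\int[leb]_x (f x `^ (2 * n%:R / (n%:R - 2)))%:E) `^ ((n%:R - 2) / n%:R) <=
   ((2 * (n%:R - 1) / (n%:R - 2)) ^+ 2)%:E *
   \int[leb]_x (enorm (gradient f x) ^+ 2)%:E)%E.
Proof.
move=> n3 tf f0; have sf := test_smooth tf.
have N3 : 3 <= n%:R :> R by rewrite (ler_nat _ 3).
set N : R := n%:R.
have N0 : 0 < N by apply: lt_le_trans N3.
have N1 : 0 < N - 1 by rewrite subr_gt0; apply: lt_le_trans N3; rewrite ltr1n.
have N2 : 0 < N - 2 by rewrite subr_gt0; apply: lt_le_trans N3; rewrite ltr_nat.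
set q := 2 * N / (N - 2); set g := 2 * (N - 1) / (N - 2).
have q0 : 0 < q by rewrite !mulr_gt0// invr_gt0.
have g1 : 1 < g by rewrite /g ltr_pdivlMr//; lra.
have g0 : 0 < g by exact: lt_trans g1.
have gN : g * (N / (N - 1)) = q by rewrite /g /q; field; rewrite !gt_eqF.
have gq : g - 1 = q / 2 by rewrite /g /q; field; rewrite gt_eqF.
clearbody q g.
have mf := measurable_smooth sf.
have mG := measurable_enorm_gradient sf.
pose F y := (g * (f y `^ (g - 1) * enorm (gradient f y)))%:E.
have F0 y : (0 <= F y)%E.
  by rewrite lee_fin !mulr_ge0 ?powR_ge0 ?enorm_ge0 ?(ltW g0).
have mp (r : R) : measurable_fun setT (fun x => f x `^ r).
  exact: (measurableT_comp (measurable_powR _) mf).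
have mF : measurable_fun setT F.
  apply/measurable_EFinP; apply: measurable_funM => //.
  exact: measurable_funM.
set A := (\int[leb]_x (f x `^ q)%:E)%E.
set B := (\int[leb]_x (enorm (gradient f x) ^+ 2)%:E)%E.
have A0 : (0 <= A)%E by apply: integral_ge0 => x _; rewrite lee_fin powR_ge0.
have B0 : (0 <= B)%E by apply: integral_ge0 => x _; rewrite lee_fin sqr_ge0.
have step1 : (A <= (\int[leb]_x F x) `^ (N / (N - 1)))%E.
  apply: le_trans (@gagliardo R n F _ mF F0); last exact: ltnW.
  apply: ge0_le_integral => //.
  - by move=> x _; rewrite lee_fin powR_ge0.
  - exact/measurable_EFinP.
  - apply: emeasurable_prod => i.
    apply: (measurableT_comp (measurable_poweR _)).
    exact: measurable_line_integral.
  move=> x _.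
  have -> : (f x `^ q)%:E = (\prod_(i < n) (f x `^ g)%:E `^ (N - 1)^-1)%E.
    under eq_bigr do rewrite poweR_EFin.
    rewrite prodEFin prodr_const card_ord -powR_mulrn ?powR_ge0//.
    by rewrite -!powRrM -/N -gN; congr (_ `^ _)%:E; field; rewrite gt_eqF.
  apply: lee_prod_ge0 => i; first exact: poweR_ge0.
  apply: gt0_ler_poweR; rewrite ?invr_ge0 ?(ltW N1)//.
  - by rewrite in_itv/= leey lee_fin powR_ge0.
  - by rewrite in_itv/= leey andbT; exact: line_integral_ge0.
  apply: le_trans (test_function_line_bound i x tf f0 g1) _.
  have mu1 : measurable_fun setT (fun t : measurableTypeR R => upd i t x).
    apply: measurable_fun_rowvec => j; under eq_fun do rewrite mxE.
    by case: eqP => _; [exact: measurable_id|exact: measurable_cst].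
  apply: ge0_le_integral => //.
  - by move=> t _; rewrite lee_fin !mulr_ge0 ?powR_ge0 ?(ltW g0).
  - apply/measurable_EFinP; apply: measurable_funM => //.
    apply: measurable_funM; first exact: (measurableT_comp (mp _) mu1).
    apply: measurableT_comp => //.
    exact: (measurableT_comp (measurable_smooth (smooth_partial i sf)) mu1).
  - exact: (measurableT_comp mF mu1).
  - move=> t _; rewrite lee_fin ler_pM2l// ler_wpM2l ?powR_ge0//.
    by have := ler_coord_enorm (gradient f (upd i t x)) i; rewrite mxE.
have step2 : (\int[leb]_x F x <= g%:E * (A `^ 2^-1 * B `^ 2^-1))%E.
  pose h (b : bool) x := (if b then f x `^ q else enorm (gradient f x) ^+ 2)%:E.
  have mh b : measurable_fun setT (h b).
    case: b; apply/measurable_EFinP; first exact: mp.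
    exact: measurable_funX.
  have h0 b x : (0 <= h b x)%E.
    by case: b; rewrite lee_fin ?powR_ge0 ?sqr_ge0.
  have H : (\int[leb]_x \prod_(b <- [:: true; false]) h b x `^ 2^-1 <=
      \prod_(b <- [:: true; false]) (\int[leb]_x h b x) `^ 2^-1)%E.
    apply: (@hoelder_prod _ _ R bool leb [:: true; false] (fun=> 2^-1) h) => //.
    by rewrite !big_cons big_nil addr0; lra.
  rewrite !big_cons big_nil mule1 in H.
  rewrite (eq_integral (fun x =>
      g%:E * \prod_(b <- [:: true; false]) h b x `^ 2^-1)%E); last first.
    move=> x _; rewrite /F !big_cons big_nil mule1 !poweR_EFin -!EFinM.
    congr (_ * (_ * _))%:E; first by rewrite -powRrM gq.
    by rewrite powR12_sqrt ?sqr_ge0// sqrtr_sqr ger0_norm// enorm_ge0.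
  rewrite ge0_integralZl//.
  - by apply: lee_wpmul2l => //; rewrite lee_fin ltW.
  - exact: (emeasurable_prod_poweR _ (fun=> 2^-1) mh).
  - by move=> x _; apply: prode_ge0 => b; exact: poweR_ge0.
  - by rewrite lee_fin ltW.
have Afin : (A < +oo)%E.
  have [M M0 fM] := test_function_bounded tf.
  apply: (@le_lt_trans _ _ (\int[leb]_(x in ball) (M `^ q)%:E)%E).
    rewrite /A integral_mkcond [leRHS]integral_mkcond/=.
    apply: ge0_le_integral => //.
    - by move=> x _; rewrite patchE; case: ifP => // _; rewrite lee_fin powR_ge0.
    - by rewrite patch_setT; exact/measurable_EFinP.
    - apply/(measurable_restrictT _ unit_ball_measurable).
      exact: measurable_cst.
    - move=> x _; rewrite patchE in_setT patchE; case: ifPn => xB.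
        rewrite lee_fin ge0_ler_powR ?nnegrE ?(ltW q0)// ?(ltW M0)//.
        by apply: le_trans (fM x); rewrite ler_norm.
      rewrite (test_function_eq0 tf) ?powR0 ?gt_eqF//.
      by move: xB; rewrite notin_setE.
  rewrite integral_cst//; last exact: unit_ball_measurable.
  by apply: lte_mul_pinfty; rewrite ?lee_fin ?powR_ge0// lebesgue_unit_ball_lty.
have c0 : 0 < (N - 2) / N by rewrite divr_gt0.
have step3 : (A <= (g%:E * (A `^ 2^-1 * B `^ 2^-1)) `^ (N / (N - 1)))%E.
  apply: le_trans step1 _; apply: gt0_ler_poweR => //.
  - by rewrite divr_ge0 ?ltW.
  - by rewrite in_itv/= leey andbT; exact: integral_ge0.
  - rewrite in_itv/= leey andbT mule_ge0 ?mule_ge0 ?poweR_ge0//.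
    by rewrite lee_fin ltW.
clearbody A B; move: A0 B0 Afin step3 {step1 step2}.
case: A => [a| |]//; rewrite lee_fin le_eqVlt => /predU1P[<-|a0].
  by move=> B0 _ _; rewrite poweR0r ?gt_eqF// mule_ge0// lee_fin sqr_ge0.
case: B => [b| |]//; last first.
  by move=> _ _ _; rewrite gt0_muley ?leey// lte_fin exprn_gt0.
rewrite lee_fin => b0 _; rewrite !poweR_EFin -!EFinM. rewrite !lee_fin.
move=> ab; rewrite -(ler_pM2l a0).
have d0 : 0 <= g * (a `^ 2^-1 * b `^ 2^-1) by rewrite !mulr_ge0 ?powR_ge0 ?ltW.
have -> : a * a `^ ((N - 2) / N) = a `^ (2 * (N - 1) / N).
  rewrite -[X in X * _](powRr1 (ltW a0)) -powRD ?(gt_eqF a0) ?implybT//.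
  by congr (_ `^ _); field; rewrite gt_eqF.
have -> : a * (g ^+ 2 * b) =
    ((g * (a `^ 2^-1 * b `^ 2^-1)) `^ (N / (N - 1))) `^ (2 * (N - 1) / N).
  rewrite -powRrM (_ : N / (N - 1) * _ = 2%:R); last first.
    by field; rewrite !gt_eqF.
  rewrite powR_mulrn// !exprMn !powR12_sqrt ?(ltW a0)// !sqr_sqrtr ?(ltW a0)//.
  by ring.
apply: ge0_ler_powR; rewrite ?nnegrE ?powR_ge0 ?(ltW a0)//.
by rewrite divr_ge0 ?mulr_ge0 ?ltW.
Qed.

End sobolev.

(** * A smooth approximation of the absolute value *)

Section truncated_abs.
Context {R : realType}.
Implicit Types (e t : R).

Definition sabs e t : R := Num.sqrt (t ^+ 2 + e ^+ 2) - e.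
Definition trunc e t : R := sabs e t / (1 + e * sabs e t).
Definition dtrunc e t : R :=
  t / Num.sqrt (t ^+ 2 + e ^+ 2) / (1 + e * sabs e t) ^+ 2.

Lemma sabs_ge0 e t : 0 < e -> 0 <= sabs e t.
Proof.
move=> e0; rewrite subr_ge0 -[leLHS](gtr0_norm e0) -sqrtr_sqr ler_sqrt//.
  by rewrite lerDr sqr_ge0.
by rewrite addr_ge0// sqr_ge0.
Qed.

Lemma sabs_le e t : 0 < e -> sabs e t <= `|t|.
Proof.
move=> e0; rewrite lerBlDr -[leRHS]ger0_norm ?addr_ge0 ?(ltW e0)//.
rewrite -sqrtr_sqr ler_sqrt ?sqr_ge0// sqrrD real_normK ?num_real//.
by rewrite lerD2r lerDl mulrn_wge0// mulr_ge0// ltW.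
Qed.

Lemma sabs_ge e t : 0 < e -> `|t| - e <= sabs e t.
Proof.
move=> e0; rewrite lerD2r -sqrtr_sqr ler_sqrt ?lerDl ?sqr_ge0//.
by rewrite addr_ge0// sqr_ge0.
Qed.

Lemma sqrtDsqr_gt0 e t : 0 < e -> 0 < Num.sqrt (t ^+ 2 + e ^+ 2).
Proof. by move=> e0; rewrite sqrtr_gt0 ltr_wpDl ?sqr_ge0// exprn_gt0. Qed.

Lemma trunc_den_ge1 e t : 0 < e -> 1 <= 1 + e * sabs e t.
Proof. by move=> e0; rewrite lerDl mulr_ge0 ?sabs_ge0 ?ltW. Qed.

Lemma trunc_den_gt0 e t : 0 < e -> 0 < 1 + e * sabs e t.
Proof. by move=> e0; apply: lt_le_trans (trunc_den_ge1 t e0). Qed.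

Lemma sabs0 e : 0 < e -> sabs e 0 = 0.
Proof. by move=> e0; rewrite /sabs expr0n add0r sqrtr_sqr gtr0_norm// subrr. Qed.

Lemma trunc0 e : 0 < e -> trunc e 0 = 0.
Proof. by move=> e0; rewrite /trunc sabs0// mul0r. Qed.

Lemma dtrunc0 e : dtrunc e 0 = 0.
Proof. by rewrite /dtrunc !mul0r. Qed.

Lemma trunc_ge0 e t : 0 < e -> 0 <= trunc e t.
Proof.
by move=> e0; rewrite divr_ge0 ?sabs_ge0// ltW// trunc_den_gt0.
Qed.

Lemma trunc_le e t : 0 < e -> trunc e t <= `|t|.
Proof.
move=> e0; apply: le_trans (sabs_le t e0).
by rewrite ler_pdivrMr ?trunc_den_gt0// ler_peMr ?sabs_ge0// trunc_den_ge1.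
Qed.

Lemma trunc_le_inv e t : 0 < e -> trunc e t <= e^-1.
Proof.
move=> e0; rewrite ler_pdivrMr ?trunc_den_gt0// mulrDr mulr1 mulKf ?gt_eqF//.
by rewrite lerDr invr_ge0 ltW.
Qed.

Lemma trunc_gt0 e t : 0 < e -> t != 0 -> 0 < trunc e t.
Proof.
move=> e0 t0; rewrite divr_gt0 ?trunc_den_gt0// subr_gt0.
rewrite -[ltLHS](gtr0_norm e0) -sqrtr_sqr ltr_sqrt.
  by rewrite ltrDr exprn_even_gt0.
by rewrite ltr_wpDl ?sqr_ge0// exprn_gt0.
Qed.

Lemma dtrunc_ge0 e t : 0 < e -> 0 <= t -> 0 <= dtrunc e t.
Proof. by move=> e0 t0; rewrite !divr_ge0 ?sqrtr_ge0 ?sqr_ge0. Qed.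

Lemma dtrunc_le1 e t : 0 < e -> `|dtrunc e t| <= 1.
Proof.
move=> e0; have d1 := trunc_den_ge1 t e0.
rewrite /dtrunc normrM normfV (ger0_norm (sqr_ge0 _)).
rewrite ler_pdivrMr ?exprn_gt0 ?trunc_den_gt0// mul1r.
apply: (@le_trans _ _ 1); last by rewrite exprn_ege1.
rewrite normrM normfV (gtr0_norm (sqrtDsqr_gt0 t e0)).
rewrite ler_pdivrMr ?sqrtDsqr_gt0// mul1r -sqrtr_sqr ler_sqrt ?lerDl ?sqr_ge0//.
by rewrite addr_ge0// sqr_ge0.
Qed.

Lemma is_derive_sabs e t : 0 < e ->
  is_derive t (1 : R) (sabs e) (t / Num.sqrt (t ^+ 2 + e ^+ 2)).
Proof.
move=> e0; have p0 : 0 < t ^+ 2 + e ^+ 2 by rewrite ltr_wpDl ?sqr_ge0// exprn_gt0.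
have d1 : is_derive t (1 : R) (fun t => t ^+ 2 + e ^+ 2) (2 * t).
  have := is_deriveD (is_deriveX 2 (is_derive_id t (1 : R)))
    (is_derive_cst (e ^+ 2) t (1 : R)).
  move=> H; apply: is_derive_eq H _.
  by rewrite addr0 expr1 /GRing.scale/= mulr1 mulr_natl.
have d2 := @is_derive_chain _ _ Num.sqrt (fun t => t ^+ 2 + e ^+ 2) t 1 _ _
  (is_derive1_sqrt p0) d1.
have := is_deriveD d2 (is_derive_cst (- e) t (1 : R)).
move=> H; apply: is_derive_eq H _.
by rewrite addr0; field; rewrite gt_eqF// sqrtDsqr_gt0.
Qed.

Lemma is_derive_trunc e t : 0 < e -> is_derive t (1 : R) (trunc e) (dtrunc e t).
Proof.
move=> e0; have ds := is_derive_sabs t e0.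
have dd : is_derive t (1 : R) (fun t => 1 + e * sabs e t)
    (e * (t / Num.sqrt (t ^+ 2 + e ^+ 2))).
  have := is_deriveD (is_derive_cst (1 : R) t (1 : R)) (is_deriveZ e ds).
  by move=> H; apply: is_derive_eq H _; rewrite add0r.
have n0 : 1 + e * sabs e t != 0 by rewrite gt_eqF// trunc_den_gt0.
have := is_deriveM ds (@is_derive_chain _ _ GRing.inv
  (fun t => 1 + e * sabs e t) t 1 _ _ (is_derive_inv n0) dd).
move=> H; apply: is_derive_eq H _; rewrite /GRing.scale/= /dtrunc.
by field; rewrite n0 gt_eqF// sqrtDsqr_gt0.
Qed.

Lemma continuous_trunc e : 0 < e -> continuous (trunc e).
Proof.
move=> e0 t; apply: differentiable_continuous; apply/derivable1_diffP.
by case: (is_derive_trunc t e0).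
Qed.

Lemma continuous_dtrunc e : 0 < e -> continuous (dtrunc e).
Proof.
move=> e0.
have c1 : continuous (fun t => t / Num.sqrt (t ^+ 2 + e ^+ 2)).
  rewrite (_ : (fun t => _) = (fun t => t * (sabs e t + e)^-1)); last first.
    by apply/funext => t; rewrite subrK.
  apply: continuous_mulf; first by move=> s; exact: cvg_id.
  apply: continuous_invf; first by move=> t; rewrite subrK gt_eqF// sqrtDsqr_gt0.
  apply: continuous_addf; last exact: cst_continuous.
  move=> s; apply: differentiable_continuous; apply/derivable1_diffP.
  by case: (is_derive_sabs s e0).
apply: continuous_mulf => //; apply: continuous_invf => [t|].
  by rewrite expf_neq0// gt_eqF// trunc_den_gt0.
rewrite (_ : (fun t => _) = (fun t =>
   (1 + e * sabs e t) * (1 + e * sabs e t))); last first.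
  by apply/funext => s; rewrite expr2.
have c : continuous (fun t => 1 + e * sabs e t).
  apply: continuous_addf; first exact: cst_continuous.
  apply: continuous_mulf; first exact: cst_continuous.
  move=> s; apply: differentiable_continuous; apply/derivable1_diffP.
  by case: (is_derive_sabs s e0).
exact: continuous_mulf.
Qed.

Lemma smooth_trunc n (f : 'rV[R]_n -> R) e : 0 < e -> smooth f ->
  smooth (fun x => trunc e (f x)).
Proof.
move=> e0 /smoothP Cf; apply/smoothP => m.
have Cs : Ck m (fun x => sabs e (f x)).
  apply: (CkD (f := fun x => Num.sqrt (f x ^+ 2 + e ^+ 2)) _ (Ck_cst m (- e))).
  apply: Ck_sqrt; first by move=> x; rewrite ltr_wpDl ?sqr_ge0// exprn_gt0.
  exact: (CkD (CkM (Cf m) (Cf m)) (Ck_cst m (e ^+ 2))).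
apply: (CkM Cs); apply: CkV; first by move=> x; rewrite gt_eqF// trunc_den_gt0.
exact: (CkD (Ck_cst m 1) (CkM (Ck_cst m e) Cs)).
Qed.

Lemma test_function_trunc n (D : set 'rV[R]_n) f e : 0 < e ->
  test_function D f -> test_function D (fun x => trunc e (f x)).
Proof.
move=> e0 tf; apply: (test_function_sub tf).
  exact: smooth_trunc (test_smooth tf).
by move=> x ->; exact: trunc0.
Qed.

Lemma partial_trunc n (f : 'rV[R]_n -> R) e i x : 0 < e -> smooth f ->
  partial i (fun x => trunc e (f x)) x = dtrunc e (f x) * partial i f x.
Proof. by move=> e0 sf; apply: partial_chain => //; exact: is_derive_trunc. Qed.

Let eps (k : nat) : R := k.+1%:R^-1.

Lemma cvg_sabs t : (fun k => sabs (eps k) t) @ \oo --> `|t|.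
Proof.
have e0 k : 0 < eps k by rewrite invr_gt0.
apply: (@squeeze_cvgr _ _ _ _ (fun k => `|t| - eps k) (fun=> `|t|)).
- by apply: nearW => k; rewrite sabs_ge// sabs_le.
- rewrite -[X in _ --> X]subr0; apply: cvgB; first exact: cvg_cst.
  exact: cvg_harmonic.
- exact: cvg_cst.
Qed.

Let cvg_den t : (fun k => 1 + eps k * sabs (eps k) t) @ \oo --> (1 : R).
Proof.
rewrite -[X in _ --> X]addr0 -(mul0r `|t|); apply: cvgD; first exact: cvg_cst.
by apply: cvgM; [exact: cvg_harmonic|exact: cvg_sabs].
Qed.

Lemma cvg_trunc t : (fun k => trunc k.+1%:R^-1 t) @ \oo --> `|t|.
Proof.
rewrite -[X in _ --> X]divr1; apply: cvgM; first exact: cvg_sabs.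
by apply: cvgV; [exact: oner_neq0|exact: cvg_den].
Qed.

Lemma cvg_dtrunc t : 0 < t -> (fun k => dtrunc k.+1%:R^-1 t) @ \oo --> (1 : R).
Proof.
move=> t0; rewrite -[X in _ --> X]divr1 -[X in X / _](divff (lt0r_neq0 t0)).
apply: cvgM.
  apply: cvgM; first exact: cvg_cst.
  apply: cvgV; first exact: lt0r_neq0.
  rewrite (_ : (fun k => _) = (fun k => sabs (eps k) t + eps k)); last first.
    by apply/funext => k; rewrite subrK.
  rewrite -[X in _ --> X]addr0; apply: cvgD; last exact: cvg_harmonic.
  by rewrite -[X in _ --> X](gtr0_norm t0); exact: cvg_sabs.
apply: cvgV; first exact: oner_neq0.
rewrite -[X in _ --> X](expr1n _ 2); 
exact: (cvgM (@cvg_den t) (@cvg_den t)).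
Qed.

End truncated_abs.

(** * Approximation by test functions *)

Section dominated_subsequence.
Context d (T : measurableType d) {R : realType} (mu : {measure set T -> \bar R}).
Variables (D : set T) (mD : measurable D) (f : (T -> R)^nat).
Hypothesis mf : forall k, measurable_fun D (f k).
Hypothesis f0 : forall k x, 0 <= f k x.
Hypothesis f_small : forall e : R, 0 < e ->
  exists k, (\int[mu]_(x in D) (f k x)%:E <= e%:E)%E.

(* Along a subsequence with summable integrals, the sum of the series is an
   integrable majorant. *)
Lemma dominated_subsequence : exists (s : nat -> nat) (S : T -> R),
  [/\ measurable_fun D S, mu.-integrable D (EFin \o S),
    forall x, 0 <= S x,
    {ae mu, forall x, D x -> forall k, f (s k) x <= S x} &
    {ae mu, forall x, D x -> (fun k => f (s k) x) @ \oo --> 0}].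
Proof.
have /choice[s sP] : forall k, exists m,
    (\int[mu]_(x in D) (f m x)%:E <= (1 / (2 ^ k.+1)%:R)%:E)%E.
  by move=> k; apply: f_small; rewrite divr_gt0// ltr0n expn_gt0.
pose g k x := (f (s k) x)%:E.
have g0 k x : (0 <= g k x)%E by rewrite lee_fin.
have mg k : measurable_fun D (g k) by exact/measurable_EFinP.
pose S x := (\sum_(0 <= k <oo) g k x)%E.
have mS : measurable_fun D S.
  by apply: ge0_emeasurable_sum => // k x _ _; exact: g0.
have S0 x : (0 <= S x)%E by apply: nneseries_ge0 => k _ _.
have IS : (\int[mu]_(x in D) S x < +oo)%E.
  rewrite integral_nneseries//.
  apply: (@le_lt_trans _ _ (\sum_(0 <= k <oo) (1 / (2 ^ k.+1)%:R)%:E)%E).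
    apply: lee_nneseries => k _; last exact: sP.
    by move=> _; apply: integral_ge0 => x _; exact: g0.
  apply: le_lt_trans (epsilon_trick0 _ _) _; first exact: ler01.
  exact: ltry.
have iS : mu.-integrable D S.
  apply/integrableP; split => //.
  by under eq_integral do rewrite gee0_abs//.
have finS := integrable_ae mD iS.
have g_le k x : (g k x <= S x)%E.
  rewrite /S (nneseriesD1 (n := k))//.
  rewrite -[leLHS]adde0; apply: leeD => //.
  by apply: nneseries_ge0 => j _ _; exact: g0.
exists s, (fun x => fine (S x)); split.
- exact: measurableT_comp.
- apply: (le_integrable mD _ _ iS).
    by apply/measurable_EFinP; exact: measurableT_comp.
  move=> x _ /=; rewrite (gee0_abs (S0 x)) ger0_norm ?fine_ge0//.
  by case: (S x) (S0 x) => [r||]//= _; rewrite leey.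
- by move=> x; exact: fine_ge0.
- apply: filterS finS => x /[apply] finSx k.
  by rewrite -lee_fin fineK//; exact: g_le.
- apply: filterS finS => x /[apply] finSx.
  apply: cvg_series_cvg_0; apply: nnseries_is_cvg => //.
  by rewrite ltey; move: finSx; rewrite fin_numE => /andP[].
Qed.

End dominated_subsequence.
Section H10_approximation.
Context {R : realType} {n : nat}.
Notation leb := (@lebesgue_rV R n).
Implicit Types (u f : 'rV[R]_n -> R) (D : set 'rV[R]_n).

Lemma Lp_norm_powR D (p : R) f : p != 0 ->
  (Lp_norm D p f `^ p = \int[leb]_(x in D) (`|f x| `^ p)%:E)%E.
Proof.
move=> p0; rewrite /Lp_norm poweR_Lnorm// [RHS]integral_mkcond.
apply: eq_integral => x _; rewrite /= /patch; case: ifP => // _.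
by rewrite normr0 powR0.
Qed.

Lemma measurable_enorm_comp D (v : 'rV[R]_n -> 'rV[R]_n) :
  (forall i, measurable_fun D (fun x => v x ord0 i)) ->
  measurable_fun D (fun x => enorm (v x)).
Proof.
move=> mv.
apply: (measurableT_comp (continuous_measurable_fun (@sqrt_continuous R))).
by apply: measurable_sum => i; apply: measurable_funM.
Qed.

Lemma measurable_coord_comp D (v : 'rV[R]_n -> 'rV[R]_n) i :
  measurable_fun D v -> measurable_fun D (fun x => v x ord0 i).
Proof. by move=> mv; exact: (measurableT_comp (measurable_coord i) mv). Qed.

Lemma test_approximation D u (g : 'rV[R]_n -> 'rV[R]_n)
    (phi : nat -> 'rV[R]_n -> R) :
  measurable D -> measurable_fun D u -> measurable_fun D g ->
  (forall k, test_function D (phi k)) ->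
  (Lp_norm D 2 (u \- phi k) @[k --> \oo] --> 0%E) ->
  (Lp_norm D 2 (fun x => enorm (g x - gradient (phi k) x)) @[k --> \oo] --> 0%E) ->
  exists (psi : nat -> 'rV[R]_n -> R) (S : 'rV[R]_n -> R),
  [/\ (forall k, test_function D (psi k)),
    [/\ measurable_fun D S, leb.-integrable D (EFin \o S) & forall x, 0 <= S x],
    {ae leb, forall x, D x -> forall k i,
       `|partial i (psi k) x| <= enorm (g x) + Num.sqrt (S x)} &
    {ae leb, forall x, D x -> (fun k => psi k x) @ \oo --> u x /\
       forall i, (fun k => partial i (psi k) x) @ \oo --> g x ord0 i}].
Proof.
move=> mD mu mg tphi cu cg.
pose f k x := (u x - phi k x) ^+ 2 + enorm (g x - gradient (phi k) x) ^+ 2.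
have f0 k x : 0 <= f k x by rewrite addr_ge0 ?sqr_ge0.
have mphi k : measurable_fun D (phi k).
  by apply: measurable_funTS; exact: measurable_smooth (test_smooth (tphi k)).
have mf1 k : measurable_fun D (fun x => (u x - phi k x) ^+ 2).
  by apply: measurable_funX; exact: measurable_funB.
have mf2 k : measurable_fun D (fun x => enorm (g x - gradient (phi k) x) ^+ 2).
  apply: measurable_funX; apply: measurable_enorm_comp => i.
  under eq_fun do rewrite !mxE.
  apply: measurable_funB; first exact: measurable_coord_comp.
  apply: measurable_funTS.
  exact: measurable_smooth (smooth_partial i (test_smooth (tphi k))).
have mf k : measurable_fun D (f k) by exact: measurable_funD.
have small e : 0 < e -> exists k, (\int[leb]_(x in D) (f k x)%:E <= e%:E)%E.
  move=> e0; pose d := Num.sqrt (e / 2).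
  have d0 : 0 < d by rewrite sqrtr_gt0 divr_gt0.
  have near_le (l : nat -> \bar R) : l @ \oo --> 0%E ->
      \forall k \near \oo, (l k <= d%:E)%E.
    move=> /fine_cvgP[lf /cvgr0Pnorm_lt/(_ _ d0)]; apply: filterS2 lf => k lk.
    by move=> /ltW dk; rewrite -(fineK lk) lee_fin; apply: le_trans (ler_norm _) dk.
  have [k0 _ /(_ k0 (leqnn _)) [k1 k2]] := filterI (near_le _ cu) (near_le _ cg).
  exists k0.
  have sq (v : 'rV[R]_n -> R) : (Lp_norm D 2 v <= d%:E)%E ->
      (\int[leb]_(x in D) (v x ^+ 2)%:E <= (e / 2)%:E)%E.
    move=> vd; have -> : (\int[leb]_(x in D) (v x ^+ 2)%:E =
        \int[leb]_(x in D) (`|v x| `^ 2%:R)%:E)%E.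
      by apply: eq_integral => x _; rewrite powR_mulrn// real_normK ?num_real.
    rewrite -Lp_norm_powR ?pnatr_eq0//.
    have -> : e / 2 = d `^ 2%:R.
      by rewrite powR_mulrn ?(ltW d0)// sqr_sqrtr// divr_ge0 ?ltW.
    rewrite -poweR_EFin; apply: gt0_ler_poweR => //.
    - by rewrite in_itv/= leey andbT; exact: Lnorm_ge0.
    - by rewrite in_itv/= leey andbT lee_fin ltW.
  rewrite /f; under eq_integral do rewrite EFinD.
  rewrite ge0_integralD//.
  - by rewrite [e in leRHS]splitr EFinD; apply: leeD; exact: sq.
  - by move=> x _; rewrite lee_fin sqr_ge0.
  - exact/measurable_EFinP.
  - by move=> x _; rewrite lee_fin sqr_ge0.
  - exact/measurable_EFinP.
have [s [S [mS iS S0 fS fs0]]] := dominated_subsequence mD mf f0 small.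
exists (phi \o s), S; split => //=.
- apply: filterS fS => x /[apply] fSx k i.
  rewrite -(subrK (g x ord0 i) (partial i _ x)) addrC.
  apply: le_trans (ler_normD _ _) _; apply: lerD; first exact: ler_coord_enorm.
  rewrite distrC; have := ler_coord_enorm (g x - gradient (phi (s k)) x) i.
  rewrite !mxE => /le_trans; apply.
  rewrite -[leLHS]ger0_norm ?enorm_ge0// -sqrtr_sqr ler_sqrt//.
  by apply: le_trans (fSx k); rewrite lerDr sqr_ge0.
- apply: filterS fs0 => x /[apply] fx.
  have sq (v : nat -> R) (l : R) : (forall k, (l - v k) ^+ 2 <= f (s k) x) ->
      v @ \oo --> l.
    move=> vl; apply/cvgrPdist_lt => e e0.
    have e20 : 0 < e ^+ 2 by rewrite exprn_gt0.
    move/cvgr0Pnorm_lt: fx => /(_ _ e20); apply: filterS => k.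
    rewrite (ger0_norm (f0 _ _)) => fe.
    rewrite -(ltr_pXn2r (ltn0Sn 1)) ?nnegrE ?(ltW e0)//.
    by rewrite real_normK ?num_real//; apply: le_lt_trans fe.
  split; first by apply: sq => k; rewrite lerDl sqr_ge0.
  move=> i; apply: sq => k.
  apply: (@le_trans _ _ (enorm (g x - gradient (phi (s k)) x) ^+ 2)); last first.
    by rewrite lerDr sqr_ge0.
  rewrite -real_normK ?num_real// ler_pXn2r ?nnegrE ?enorm_ge0//.
  by have := ler_coord_enorm (g x - gradient (phi (s k)) x) i; rewrite !mxE.
Qed.

End H10_approximation.

(** * Smooth functions separate integrable functions *)

Section orthants.
Context {R : realType} {n : nat}.
Implicit Types (a x : 'rV[R]_n).

Definition orthant a : set 'rV[R]_n := [set x | forall j, a ord0 j <= x ord0 j].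

Lemma orthant_preimage a : orthant a =
  \bigcap_(j in [set: 'I_n]) ((fun x => x ord0 j) @^-1` `[a ord0 j, +oo[%classic).
Proof.
apply/seteqP; split => x /= ax j; [move=> _ /=|]; rewrite ?in_itv/= ?andbT.
  exact: ax.
by have := ax j Logic.I; rewrite /= in_itv/= andbT.
Qed.

Lemma measurable_orthant a : measurable (orthant a).
Proof.
rewrite orthant_preimage; apply: fin_bigcap_measurable => // j _.
have := @measurable_coord R n j measurableT _ (measurable_itv `[a ord0 j, +oo[).
by rewrite setTI.
Qed.

Lemma orthant_setI_closed : setI_closed (range orthant).
Proof.
move=> _ _ [a _ <-] [b _ <-]; exists (\row_j Num.max (a ord0 j) (b ord0 j)) => //.
apply/seteqP; split => x /=.
  by move=> h; split => j; have := h j; rewrite mxE ge_max => /andP[].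
by move=> [ha hb] j; rewrite mxE ge_max ha hb.
Qed.

Lemma measurable_rowvec_orthants :
  @measurable _ 'rV[R]_n = <<s range orthant >>.
Proof.
apply/seteqP; split; last first.
  apply: smallest_sub; first exact: sigma_algebra_measurable.
  by move=> _ [a _ <-]; exact: measurable_orthant.
apply: smallest_sub; first exact: smallest_sigma_algebra.
move=> A; rewrite -bigcup_seq => -[i _ [B mB <-]].
suff : measurable_fun setT (fun x : g_sigma_algebraType (range orthant) =>
    x ord0 i : measurableTypeR R) by move=> /(_ measurableT _ mB).
apply: (measurability _ (RGenCInfty.measurableE R)) => _ [_ [c ->] <-].
rewrite setTI.
rewrite (_ : _ @^-1` _ = \bigcup_(m : nat)
   (orthant (\row_j (if j == i then c else - m%:R)) : set (g_sigma_algebraType (range orthant)))).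
  apply: bigcup_measurable => m _; apply: sub_sigma_algebra.
  by exists (\row_j (if j == i then c else - m%:R)).
apply/seteqP; split => x /=.
  rewrite in_itv/= andbT => cx.
  exists (Num.bound (enorm x)) => // j; rewrite mxE; case: eqP => [->//|_].
  rewrite lerNl; apply: le_trans (ler_norm _) _; rewrite normrN.
  apply: le_trans (ler_coord_enorm _ _) _; apply: ltW.
  by apply: archi_boundP; exact: enorm_ge0.
by move=> [m _ /(_ i)]; rewrite mxE eqxx in_itv/= andbT.
Qed.

End orthants.

Section smooth_steps.
Context {R : realType}.

Definition logistic (t : R) : R := (1 + expR (- t))^-1.

Lemma logistic_ge0 t : 0 <= logistic t.
Proof. by rewrite invr_ge0 addr_ge0// expR_ge0. Qed.

Lemma logistic_le1 t : logistic t <= 1.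
Proof. by rewrite invf_le1 ?lerDl ?expR_ge0// ltr_wpDr ?expR_ge0. Qed.

Lemma expRN_nat_le (m : nat) : expR (- m%:R : R) <= m.+1%:R^-1.
Proof.
rewrite expRN lef_pV2 ?posrE ?expR_gt0//.
by rewrite -natr1 addrC expR_ge1Dx.
Qed.

Lemma logistic_ge (t : R) : 1 - expR (- t) <= logistic t.
Proof.
have e0 := expR_gt0 (- t); have d0 : 0 < 1 + expR (- t) by rewrite addr_gt0.
rewrite -(ler_pM2r d0) mulVf ?gt_eqF//.
have : 0 <= expR (- t) * expR (- t) by rewrite mulr_ge0 ?expR_ge0.
by rewrite mulrDr mulrBl; lra.
Qed.

Lemma logistic_le (t : R) : logistic t <= expR t.
Proof.
rewrite -[leRHS]invrK -expRN lef_pV2 ?posrE ?expR_gt0 ?addr_gt0 ?expR_gt0//.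
by rewrite lerDr.
Qed.

(* The extra [+ m] makes the limit at [0] equal to [1]. *)
Lemma cvg_logistic_step (c : R) :
  (fun m : nat => logistic (m%:R ^+ 2 * c + m%:R)) @ \oo --> ((0 <= c)%R%:R : R).
Proof.
have h : (fun m : nat => m.+1%:R^-1 : R) @ \oo --> (0 : R) by exact: cvg_harmonic.
have [c0|c0] := leP 0 c.
  apply: (@squeeze_cvgr _ _ _ _ (fun m => 1 - m.+1%:R^-1) (fun=> 1)).
  - apply: nearW => m; rewrite logistic_le1 andbT.
    apply: le_trans (logistic_ge _); rewrite lerD2l lerN2.
    apply: le_trans (expRN_nat_le m); rewrite ler_expR lerN2 lerDr.
    by rewrite mulr_ge0// sqr_ge0.
  - by rewrite -[X in _ --> X]subr0; apply: cvgB => //; exact: cvg_cst.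
  - exact: cvg_cst.
apply: (@squeeze_cvgr _ _ _ _ (fun=> 0) (fun m => m.+1%:R^-1)) => //; last first.
  exact: cvg_cst.
near=> m; rewrite logistic_ge0/=.
apply: le_trans (logistic_le _) _; apply: le_trans (expRN_nat_le m).
have mc : 2 <= m%:R * - c.
  rewrite -ler_pdivrMr ?oppr_gt0//.
  by near: m; exact: nbhs_infty_ger.
rewrite ler_expR -subr_ge0.
rewrite (_ : _ - _ = m%:R * (m%:R * - c - 2)); last by ring.
by rewrite mulr_ge0// subr_ge0.
Unshelve. all: by end_near. Qed.

Context {n : nat}.

Definition smooth_orthant (m : nat) (a x : 'rV[R]_n) : R :=
  \prod_(j < n) logistic (m%:R ^+ 2 * (x ord0 j - a ord0 j) + m%:R).

Lemma smooth_smooth_orthant m a : smooth (smooth_orthant m a).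
Proof.
apply: smooth_prod => j; apply/smoothP => k.
apply: (CkV (f := fun x : 'rV[R]_n =>
  1 + expR (- (m%:R ^+ 2 * (x ord0 j - a ord0 j) + m%:R)))).
  by move=> x; rewrite gt_eqF// addr_gt0 ?expR_gt0.
apply: (CkD (Ck_cst k 1)); apply: Ck_expR.
rewrite (_ : (fun x => _) = fun x : 'rV[R]_n =>
  - m%:R ^+ 2 * x ord0 j + (m%:R ^+ 2 * a ord0 j - m%:R)); last first.
  by apply/funext => x; ring.
exact: (CkD (CkM (Ck_cst k _) (Ck_coord k j)) (Ck_cst k _)).
Qed.

Lemma smooth_orthant_ge0 m a x : 0 <= smooth_orthant m a x.
Proof. by apply: prodr_ge0 => j _; exact: logistic_ge0. Qed.

Lemma smooth_orthant_le1 m a x : smooth_orthant m a x <= 1.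
Proof. by apply: prodr_ile1 => j _; rewrite logistic_ge0 logistic_le1. Qed.

Lemma cvg_smooth_orthant a x :
  (fun m => smooth_orthant m a x) @ \oo --> (\1_(orthant a) x : R).
Proof.
have -> : \1_(orthant a) x = \prod_(j < n) ((0 <= x ord0 j - a ord0 j)%R)%:R :> R.
  rewrite indicE; have [xa|xa] := boolP (x \in orthant a).
    rewrite big1// => j _; move: xa; rewrite inE => /(_ j).
    by rewrite subr_ge0 => ->.
  have [j xj] : exists j, ~~ (a ord0 j <= x ord0 j).
    apply: contrapT => h; move/negP: xa; apply; rewrite inE => j.
    by apply: contrapT => /negP xj; apply: h; exists j.
  by rewrite (bigD1 j)//= subr_ge0 (negbTE xj) mul0r.
rewrite /smooth_orthant; elim: (index_enum _) => [|j s IH].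
  by rewrite big_nil; under eq_fun do rewrite big_nil; exact: cvg_cst.
rewrite big_cons; under eq_fun do rewrite big_cons.
by apply: cvgM => //; exact: cvg_logistic_step.
Qed.

End smooth_steps.

Section smooth_duality.
Context {R : realType} {n : nat}.
Variables (mu : {measure set 'rV[R]_n -> \bar R}) (D : set 'rV[R]_n).
Variable (f : 'rV[R]_n -> R).
Hypothesis mD : measurable D.
Hypothesis fi : mu.-integrable D (EFin \o f).
Hypothesis f0 : forall p, smooth p -> (forall x, `|p x| <= 1) ->
  (\int[mu]_(x in D) (f x * p x)%:E = 0)%E.

Let mf : measurable_fun D f.
Proof. by apply/measurable_EFinP; exact: measurable_int fi. Qed.

Let integral_orthant a : (\int[mu]_(x in orthant a `&` D) (f x)%:E = 0)%E.
Proof.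
have ind : measurable_fun D (\1_(orthant a) : 'rV[R]_n -> R).
  by apply: measurable_funTS; apply: measurable_indic; exact: measurable_orthant.
have b1 m x : `|smooth_orthant m a x| <= 1.
  by rewrite ger0_norm ?smooth_orthant_ge0// smooth_orthant_le1.
have ifn : mu.-integrable D (EFin \o (fun x => `|f x|)).
  exact: (integrable_abse fi).
have H : (fun m => \int[mu]_(x in D) (f x * smooth_orthant m a x)%:E)%E @ \oo -->
    (\int[mu]_(x in D) (f x * \1_(orthant a) x)%:E)%E.
  apply: (@real_dominated_cvg _ _ _ mu D mD _ _ (fun x => `|f x|)) => //.
  - move=> m; apply: measurable_funM => //; apply: measurable_funTS.
    exact: measurable_smooth (smooth_smooth_orthant m a).
  - exact: measurable_funM.
  - apply: nearW => x _; apply: cvgM; first exact: cvg_cst.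
    exact: cvg_smooth_orthant.
  - by apply: nearW => x _ m; rewrite normrM ler_piMr.
have E : (\int[mu]_(x in D) (f x * \1_(orthant a) x)%:E = 0)%E.
  move: H; rewrite (_ : (fun m => _) = fun=> 0%E); last first.
    by apply/funext => m; exact: f0 (smooth_smooth_orthant m a) (b1 m).
  by move=> H; apply: (cvg_unique _ H) => //; exact: cvg_cst.
rewrite -[RHS]E setIC integral_mkcondr; apply: eq_integral => x _.
rewrite /patch indicE; case: ifP => _; by rewrite ?mulr1 ?mulr0.
Qed.

Lemma smooth_duality : {ae mu, forall x, D x -> f x = 0}.
Proof.
have all0 A : measurable A -> (\int[mu]_(x in A `&` D) (f x)%:E = 0)%E.
  rewrite measurable_rowvec_orthants; move: A.
  apply: (dynkin_induction measurable_rowvec_orthants orthant_setI_closed).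
  - rewrite setTI -[RHS](f0 (smooth_cst 1)); last by move=> x; rewrite normr1.
    by apply: eq_integral => x _; rewrite mulr1.
  - by move=> _ [a _ <-]; exact: integral_orthant.
  - move=> A mA A0; have : (\int[mu]_(x in D) (f x)%:E = 0)%E.
      rewrite -[RHS](f0 (smooth_cst 1)); last by move=> x; rewrite normr1.
      by apply: eq_integral => x _; rewrite mulr1.
    have -> : D = (A `&` D) `|` (~` A `&` D) by rewrite -setIUl setUCr setTI.
    rewrite integral_setU; first by rewrite A0 add0e -setIUl setUCr setTI.
    + exact: measurableI.
    + by apply: measurableI => //; exact: measurableC.
    + by rewrite -setIUl setUCr setTI; exact/measurable_EFinP.
    + by rewrite disj_set2E setIACA setICr set0I.
  - move=> F mF tF F0; rewrite setI_bigcupl integral_bigcup.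
    + by apply: eseries0 => k _ _; exact: F0.
    + exact: trivIset_setIr.
    + by move=> k; exact: measurableI.
    + apply: integrableS fi => //; first by apply: bigcup_measurable => k _; exact: measurableI.
      by move=> x [k _ []].
have := @integral_ae_eq _ _ _ mu D mD (cst 0%E) _ fi (measurable_cst _).
case=> [E ED mE|N [mN N0 sub]].
  by rewrite integral0 -[E](setIidl ED); exact: all0.
exists N; split => // x /= nx; apply: sub => /= h; apply: nx => Dx.
by have [] := h Dx.
Qed.

End smooth_duality.

(** * Square integrable functions *)

Section square_integrable.
Context d (T : measurableType d) {R : realType} (mu : {measure set T -> \bar R}).
Variables (D : set T) (mD : measurable D).
Implicit Types f g : T -> R.

Definition L2 f := measurable_fun D f /\
  mu.-integrable D (EFin \o (fun x => f x ^+ 2)).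

Lemma L2_le f g : measurable_fun D f -> (forall x, D x -> `|f x| <= `|g x|) ->
  L2 g -> L2 f.
Proof.
move=> mf fg [mg ig]; split => //; apply: le_integrable ig => //.
  by apply/measurable_EFinP; exact: measurable_funX.
move=> x Dx /=; rewrite lee_fin !ger0_norm ?sqr_ge0//.
rewrite -(real_normK (num_real (f x))) -(real_normK (num_real (g x))).
by rewrite ler_pXn2r ?nnegrE// fg.
Qed.

Lemma L2_integrableM f g : L2 f -> L2 g ->
  mu.-integrable D (EFin \o (fun x => f x * g x)).
Proof.
move=> [mf i_f] [mg ig].
have := integrableD mD i_f ig; apply: le_integrable => //.
  by apply/measurable_EFinP; exact: measurable_funM.
move=> x Dx /=; rewrite lee_fin normrM.
rewrite (ger0_norm (addr_ge0 (sqr_ge0 _) (sqr_ge0 _))).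
rewrite -(real_normK (num_real (f x))) -(real_normK (num_real (g x))).
have := sqr_ge0 (`|f x| - `|g x|); have := normr_ge0 (f x); have := normr_ge0 (g x).
by nra.
Qed.

Lemma L2D f g : L2 f -> L2 g -> L2 (fun x => f x + g x).
Proof.
move=> [mf i_f] [mg ig]; split; first exact: measurable_funD.
have := integrableZl mD 2 (integrableD mD i_f ig); apply: le_integrable => //.
  by apply/measurable_EFinP; apply: measurable_funX; exact: measurable_funD.
move=> x Dx /=; rewrite lee_fin (ger0_norm (sqr_ge0 _)).
rewrite ger0_norm; last by rewrite mulr_ge0// addr_ge0 ?sqr_ge0.
by have := sqr_ge0 (f x - g x); nra.
Qed.

Lemma L2_cst (c : R) : (mu D < +oo)%E -> L2 (fun=> c).
Proof.
move=> muD; split; first exact: measurable_cst.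
apply/integrableP; split; first exact: measurable_cst.
rewrite (_ : (fun x => _) = cst (`|c ^+ 2|)%:E)// integral_cst//.
exact: lte_mul_pinfty.
Qed.

Lemma L2_integrable f : (mu D < +oo)%E -> L2 f -> mu.-integrable D (EFin \o f).
Proof.
move=> muD Lf; have := L2_integrableM Lf (L2_cst 1 muD).
by congr (mu.-integrable D (EFin \o _)); apply/funext => x; rewrite mulr1.
Qed.

Lemma L2_norm f : L2 f -> L2 (fun x => `|f x|).
Proof.
move=> Lf; have [mf _] := Lf; apply: (L2_le _ _ Lf); last by move=> x _; rewrite normr_id.
exact: measurableT_comp.
Qed.

Lemma L2_sqrt f : measurable_fun D f -> (forall x, 0 <= f x) ->
  mu.-integrable D (EFin \o f) -> L2 (fun x => Num.sqrt (f x)).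
Proof.
move=> mf f0 i_f; split.
  by apply: (measurableT_comp (continuous_measurable_fun (@sqrt_continuous R))).
by move: i_f; congr (mu.-integrable D (EFin \o _)); apply/funext => x; rewrite sqr_sqrtr.
Qed.

Lemma integrable_boundM f g (M : R) : measurable_fun D f ->
  (forall x, D x -> `|f x| <= M) -> mu.-integrable D (EFin \o g) ->
  mu.-integrable D (EFin \o (fun x => g x * f x)).
Proof.
move=> mf fM ig; have mg : measurable_fun D g.
  by apply/measurable_EFinP; exact: measurable_int ig.
have := integrableZl mD M ig; apply: le_integrable => //.
  by apply/measurable_EFinP; exact: measurable_funM.
move=> x Dx /=; rewrite lee_fin !normrM mulrC ler_wpM2r//.
by apply: le_trans (fM _ Dx) (ler_norm _).
Qed.

Lemma hoelder_prod_on (J : eqType) (s : seq J) (p : J -> R) (f : J -> T -> R) :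
  (forall j, 0 < p j) -> \sum_(j <- s) p j = 1 ->
  (forall j, measurable_fun D (f j)) -> (forall j x, 0 <= f j x) ->
  (\int[mu]_(x in D) (\prod_(j <- s) f j x `^ p j)%:E <=
   \prod_(j <- s) (\int[mu]_(x in D) (f j x)%:E) `^ p j)%E.
Proof.
move=> p0 p1 mf f0.
pose F j := (fun x => (f j x)%:E) \_ D.
have F0 j x : (0 <= F j x)%E by rewrite /F/patch; case: ifP => //; rewrite lee_fin.
have mF j : measurable_fun setT (F j).
  by apply/(measurable_restrictT _ mD); exact/measurable_EFinP.
have := hoelder_prod mu (fun j => ltW (p0 j)) p1 mF F0.
rewrite (eq_bigr (fun j => (\int[mu]_(x in D) (f j x)%:E) `^ p j)%E); last first.
  by move=> j _; rewrite [in RHS]integral_mkcond.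
apply: le_trans; rewrite integral_mkcond le_eqVlt; apply/orP; left; apply/eqP.
apply: eq_integral => x _; rewrite /F /patch; case: ifP => xD.
  by rewrite -prodEFin; apply: eq_bigr => j _; rewrite poweR_EFin.
case: s p1 => [|j s _]; first by rewrite big_nil => /esym/eqP; rewrite oner_eq0.
by rewrite big_cons poweR0r ?mul0e// gt_eqF.
Qed.

End square_integrable.

Section smooth_bounds.
Context {R : realType} {n : nat}.

Lemma smooth_bounded_on_ball (f : 'rV[R]_n -> R) : smooth f ->
  exists M, forall x, unit_ball R n x -> `|f x| <= M.
Proof.
move=> sf; have cC : compact (cube R n).
  rewrite (_ : cube R n = [set v : 'rV[R]_n | forall i, `[(-1 : R), 1]%classic (v ord0 i)]).
    exact: (@rV_compact _ n (fun=> `[(-1 : R), 1]%classic) (fun=> @segment_compact R _ _)).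
  by apply/seteqP; split => x /= xC i; have := xC i; rewrite in_itv/= ler_norml.
have C0 : cube R n !=set0 by exists 0 => i; rewrite mxE normr0.
have cf : {within cube R n, continuous (fun x => `|f x|)}.
  apply: continuous_subspaceT; apply: continuous_normf.
  exact: smooth_continuous.
have [c _ cM] := EVT_max_rV C0 cC cf.
by exists `|f c| => x /sub_unit_ball_cube xC; apply: cM; rewrite inE.
Qed.

Lemma norm_dotv_le (x y : 'rV[R]_n) : `|dotv x y| <= n%:R * (enorm x * enorm y).
Proof.
apply: le_trans (ler_norm_sum _ _ _) _.
rewrite -[n in n%:R]card_ord mulr_natl -sumr_const; apply: ler_sum => i _.
by rewrite normrM ler_pM// ler_coord_enorm.
Qed.

Lemma Lp_vec_powR_integrable (D : set 'rV[R]_n) (p : R) (g : 'rV[R]_n -> 'rV[R]_n) :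
  0 < p -> in_Lp_vec D p g ->
  (@lebesgue_rV R n).-integrable D (EFin \o (fun x => enorm (g x) `^ p)).
Proof.
move=> p0 [mg gp]; apply/integrableP; split.
  apply/measurable_EFinP; apply: (measurableT_comp (measurable_powR _)).
  by apply: measurable_enorm_comp => i; exact: measurable_coord_comp.
have := poweR_lty p gp; rewrite Lp_norm_powR ?gt_eqF//.
apply: le_lt_trans; rewrite le_eqVlt; apply/orP; left; apply/eqP.
apply: eq_integral => x _ /=.
by rewrite (ger0_norm (powR_ge0 _ _)) ger0_norm ?enorm_ge0.
Qed.

Lemma Lp_vec2_L2 (D : set 'rV[R]_n) (g : 'rV[R]_n -> 'rV[R]_n) :
  in_Lp_vec D 2 g -> L2 (@lebesgue_rV R n) D (fun x => enorm (g x)).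
Proof.
move=> Lg; split.
  by apply: measurable_enorm_comp => i; apply: measurable_coord_comp; case: Lg.
have := Lp_vec_powR_integrable (ltr0Sn _ 1) Lg.
congr (_.-integrable D (EFin \o _)); apply/funext => x.
by rewrite powR_mulrn ?enorm_ge0.
Qed.

Lemma Lp2_L2 (D : set 'rV[R]_n) (f : 'rV[R]_n -> R) :
  in_Lp D 2 f -> L2 (@lebesgue_rV R n) D f.
Proof.
move=> [mf fp]; split => //; apply/integrableP; split.
  by apply/measurable_EFinP; exact: measurable_funX.
have := poweR_lty 2 fp; rewrite Lp_norm_powR ?pnatr_eq0//.
apply: le_lt_trans; rewrite le_eqVlt; apply/orP; left; apply/eqP.
apply: eq_integral => x _ /=.
by rewrite (ger0_norm (sqr_ge0 _)) powR_mulrn// real_normK ?num_real.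
Qed.

End smooth_bounds.

(** * The maximum principle *)

Section negative_part.
Context {R : realType} {n : nat}.
Notation leb := (@lebesgue_rV R n).
Notation B := (unit_ball R n).
Let mB : measurable B := unit_ball_measurable.
Let B_lty : (leb B < +oo)%E := lebesgue_unit_ball_lty n.

Variables (u : 'rV[R]_n -> R) (g h : 'rV[R]_n -> 'rV[R]_n).
Variables (psi : nat -> 'rV[R]_n -> R) (S : 'rV[R]_n -> R).
Let w x := - Num.min (u x) 0.
Hypothesis Lu : L2 leb B u.
Hypothesis mg : measurable_fun B g.
Hypothesis Lg : L2 leb B (fun x => enorm (g x)).
Hypothesis mh : measurable_fun B h.
Hypothesis Lh : L2 leb B (fun x => enorm (h x)).
Hypothesis wg_u : forall phi, test_function B phi -> forall i,
  \int[leb]_(x in B) (u x * partial i phi x) =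
  - \int[leb]_(x in B) (g x ord0 i * phi x).
Hypothesis wg_w : forall phi, test_function B phi -> forall i,
  \int[leb]_(x in B) (w x * partial i phi x) =
  - \int[leb]_(x in B) (h x ord0 i * phi x).
Hypothesis tpsi : forall k, test_function B (psi k).
Hypothesis mS : measurable_fun B S.
Hypothesis iS : leb.-integrable B (EFin \o S).
Hypothesis S0 : forall x, 0 <= S x.
Hypothesis dpsi_le : {ae leb, forall x, B x -> forall k i,
  `|partial i (psi k) x| <= enorm (h x) + Num.sqrt (S x)}.
Hypothesis psi_cvg : {ae leb, forall x, B x ->
  (fun k => psi k x) @ \oo --> w x /\
  forall i, (fun k => partial i (psi k) x) @ \oo --> h x ord0 i}.

Let w_ge0 x : 0 <= w x.
Proof. by rewrite /w oppr_ge0 ge_min lexx orbT. Qed.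

Let mw : measurable_fun B w.
Proof.
apply: measurableT_comp => //; apply: measurable_minr; last exact: measurable_cst.
by case: Lu.
Qed.

Let Lw : L2 leb B w.
Proof.
apply: (L2_le _ mw _ Lu) => // x _; rewrite /w normrN minEle.
by case: ifP => // _; rewrite normr0.
Qed.

Let mcoord (v : 'rV[R]_n -> 'rV[R]_n) i : measurable_fun B v ->
  measurable_fun B (fun x => v x ord0 i).
Proof. exact: measurable_coord_comp. Qed.

Let Lcoord (v : 'rV[R]_n -> 'rV[R]_n) i : measurable_fun B v ->
  L2 leb B (fun x => enorm (v x)) -> L2 leb B (fun x => v x ord0 i).
Proof.
move=> mv Lv; apply: (L2_le _ (mcoord i mv) _ Lv) => // x _.
by rewrite [leRHS]ger0_norm ?enorm_ge0// ler_coord_enorm.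
Qed.

Let E x := enorm (h x) + Num.sqrt (S x).

Let E_ge0 x : 0 <= E x.
Proof. by rewrite addr_ge0 ?enorm_ge0 ?sqrtr_ge0. Qed.

Let LE : L2 leb B E.
Proof. exact: (L2D mB Lh (L2_sqrt mS S0 iS)). Qed.

Let mpsi k : measurable_fun B (psi k).
Proof. by apply: measurable_funTS; exact: measurable_smooth (test_smooth (tpsi k)). Qed.

Let mdpsi k i : measurable_fun B (partial i (psi k)).
Proof.
apply: measurable_funTS.
exact: measurable_smooth (smooth_partial i (test_smooth (tpsi k))).
Qed.

Let mtrunc e (f : 'rV[R]_n -> R) : 0 < e -> measurable_fun B f ->
  measurable_fun B (fun x => trunc e (f x)).
Proof.
move=> e0 mf.
exact: (measurableT_comp (continuous_measurable_fun (continuous_trunc e0)) mf).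
Qed.

Let mdtrunc e (f : 'rV[R]_n -> R) : 0 < e -> measurable_fun B f ->
  measurable_fun B (fun x => dtrunc e (f x)).
Proof.
move=> e0 mf.
exact: (measurableT_comp (continuous_measurable_fun (continuous_dtrunc e0)) mf).
Qed.

Let cvg_trunc_psi e x : 0 < e -> (fun k => psi k x) @ \oo --> w x ->
  (fun k => trunc e (psi k x)) @ \oo --> trunc e (w x).
Proof.
move=> e0 pw.
exact: (cvg_comp (fun k => psi k x) (trunc e) pw (@continuous_trunc R e e0 (w x))).
Qed.

Let cvg_dtrunc_psi e x : 0 < e -> (fun k => psi k x) @ \oo --> w x ->
  (fun k => dtrunc e (psi k x)) @ \oo --> dtrunc e (w x).
Proof.
move=> e0 pw.
exact: (cvg_comp (fun k => psi k x) (dtrunc e) pw (@continuous_dtrunc R e e0 (w x))).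
Qed.

Let trunc1_le1 t : `|trunc 1 t| <= 1 :> R.
Proof. by rewrite ger0_norm ?trunc_ge0// -[leRHS]invr1 trunc_le_inv. Qed.

Let integrable_mul_test (f phi : 'rV[R]_n -> R) : L2 leb B f ->
  test_function B phi -> leb.-integrable B (EFin \o (fun x => f x * phi x)).
Proof.
move=> Lf tphi; have [M _ phiM] := test_function_bounded tphi.
apply: (integrable_boundM mB (M := M)) => //.
  by apply: measurable_funTS; exact: measurable_smooth (test_smooth tphi).
exact: L2_integrable.
Qed.

(* With [v = u + w], the product rule for [v * trunc 1 w * p] and
   [v * w = 0] leave only the term in which [v] is differentiated. *)
Let positive_part_gradient_dual i p : smooth p -> (forall x, `|p x| <= 1) ->
  (\int[leb]_(x in B)
    ((g x ord0 i + h x ord0 i) * trunc 1 (w x) * p x)%:E = 0)%E.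
Proof.
move=> sp p1.
pose chi k x := trunc 1 (psi k x) * p x.
have tchi k : test_function B (chi k).
  apply: (test_function_sub (tpsi k)).
    by apply: smoothM => //; apply: smooth_trunc => //; exact: test_smooth (tpsi k).
  by move=> x px; rewrite /chi px trunc0// mul0r.
have dchi k x : partial i (chi k) x = trunc 1 (psi k x) * partial i p x +
    p x * (dtrunc 1 (psi k x) * partial i (psi k) x).
  have sk := test_smooth (tpsi k).
  by rewrite partialM// ?partial_trunc//; exact: smooth_trunc.
have mp : measurable_fun B p by apply: measurable_funTS; exact: measurable_smooth.
have mdp : measurable_fun B (partial i p).
  by apply: measurable_funTS; exact: measurable_smooth (smooth_partial i sp).
have Lgi := Lcoord i mg Lg; have Lhi := Lcoord i mh Lh.
have Lgh := L2D mB Lgi Lhi; have Lv := L2D mB Lu Lw.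
have key k : \int[leb]_(x in B) ((u x + w x) * partial i (chi k) x) =
    - \int[leb]_(x in B) ((g x ord0 i + h x ord0 i) * chi k x).
  have td := test_function_partial i (tchi k).
  under eq_Rintegral do rewrite mulrDl.
  rewrite RintegralD//; [|exact: integrable_mul_test..].
  rewrite wg_u// wg_w// -opprD; congr (- _).
  rewrite -RintegralD//; [|exact: integrable_mul_test..].
  by apply: eq_Rintegral => x _; rewrite mulrDl.
have [P pP] := smooth_bounded_on_ball (smooth_partial i sp).
have lim1 : (fun k => \int[leb]_(x in B) ((u x + w x) * partial i (chi k) x)) @ \oo -->
    \int[leb]_(x in B) ((u x + w x) * (trunc 1 (w x) * partial i p x +
      p x * (dtrunc 1 (w x) * h x ord0 i))).
  apply: (@Rintegral_dominated_cvg _ _ _ leb B mB _ _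
    (fun x => `|u x + w x| * (P + E x))).
  - move=> k; apply: measurable_funM; first by case: Lv.
    rewrite (_ : partial i (chi k) = fun x => trunc 1 (psi k x) * partial i p x +
        p x * (dtrunc 1 (psi k x) * partial i (psi k) x)); last first.
      by apply/funext => x; exact: dchi.
    apply: measurable_funD; apply: measurable_funM => //; first exact: mtrunc.
    by apply: measurable_funM => //; exact: mdtrunc.
  - apply: measurable_funM; first by case: Lv.
    apply: measurable_funD; apply: measurable_funM => //; first exact: mtrunc.
    by apply: measurable_funM; [exact: mdtrunc|exact: mcoord].
  - apply: filterS psi_cvg => x /[apply] -[pw dpw].
    apply: cvgM; first exact: cvg_cst.
    rewrite (_ : (fun k => partial i (chi k) x) =
        (fun k => trunc 1 (psi k x) * partial i p x +
          p x * (dtrunc 1 (psi k x) * partial i (psi k) x))); last first.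
      by apply/funext => k; exact: dchi.
    apply: cvgD; first by apply: cvgM; [exact: cvg_trunc_psi|exact: cvg_cst].
    apply: cvgM; first exact: cvg_cst.
    by apply: cvgM; [exact: cvg_dtrunc_psi|exact: dpw].
  - apply: L2_integrableM => //; first exact: L2_norm.
    by apply: L2D => //; exact: L2_cst.
  - apply: filterS dpsi_le => x dpx Bx k; rewrite normrM ler_wpM2l// dchi.
    apply: le_trans (ler_normD _ _) _.
    rewrite (normrM (trunc 1 _)) (normrM (p x)) (normrM (dtrunc 1 _)).
    apply: lerD.
      by rewrite -[leRHS]mul1r ler_pM ?trunc1_le1 ?pP.
    rewrite -[leRHS]mul1r ler_pM ?mulr_ge0// -[leRHS]mul1r ler_pM ?dtrunc_le1//.
    exact: dpx.
have lim2 : (fun k => \int[leb]_(x in B) ((g x ord0 i + h x ord0 i) * chi k x)) @ \oo -->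
    \int[leb]_(x in B) ((g x ord0 i + h x ord0 i) * (trunc 1 (w x) * p x)).
  apply: (@Rintegral_dominated_cvg _ _ _ leb B mB _ _
    (fun x => `|g x ord0 i + h x ord0 i|)).
  - move=> k; apply: measurable_funM; first by case: Lgh.
    by apply: measurable_funM => //; exact: mtrunc.
  - apply: measurable_funM; first by case: Lgh.
    by apply: measurable_funM => //; exact: mtrunc.
  - apply: filterS psi_cvg => x /[apply] -[pw _].
    apply: cvgM; first exact: cvg_cst.
    by apply: cvgM; [exact: cvg_trunc_psi|exact: cvg_cst].
  - by apply: L2_integrable => //; exact: L2_norm.
  - apply: nearW => x Bx k; rewrite normrM ler_piMr// normrM.
    by rewrite -[leRHS]mul1r ler_pM ?trunc1_le1.
have vanish : \int[leb]_(x in B) ((u x + w x) * (trunc 1 (w x) * partial i p x +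
      p x * (dtrunc 1 (w x) * h x ord0 i))) = 0.
  transitivity (\int[leb]_(x in B) (0 : R)); last by rewrite /Rintegral integral0.
  apply: eq_Rintegral => x _.
  rewrite /w; case: (leP (u x) 0) => ux; first by rewrite subrr mul0r.
  by rewrite oppr0 trunc0// dtrunc0; ring.
have tp1 x : B x -> `|trunc 1 (w x) * p x| <= 1.
  by move=> _; rewrite normrM -[leRHS]mul1r ler_pM ?trunc1_le1.
have int0 : leb.-integrable B (EFin \o
    (fun x => (g x ord0 i + h x ord0 i) * (trunc 1 (w x) * p x))).
  apply: (integrable_boundM mB _ tp1); last exact: L2_integrable.
  by apply: measurable_funM => //; exact: mtrunc.
have lim0 : \int[leb]_(x in B)
    ((g x ord0 i + h x ord0 i) * (trunc 1 (w x) * p x)) = 0.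
  apply/eqP; rewrite -oppr_eq0 -vanish; apply/eqP.
  apply: (cvg_unique _ (cvgN lim2)) => //.
  by move: lim1; under eq_fun do rewrite key.
under eq_integral do rewrite -mulrA.
rewrite -[LHS]fineK; first by congr (_%:E); exact: lim0.
exact: integrable_fin_num int0.
Qed.

Lemma gradient_sign : {ae leb, forall x, B x -> w x != 0 -> g x = - h x}.
Proof.
have ae_i i : {ae leb, forall x, B x -> (g x ord0 i + h x ord0 i) * trunc 1 (w x) = 0}.
  apply: smooth_duality => //; last by move=> p; exact: positive_part_gradient_dual.
  apply: (integrable_boundM mB (M := 1)).
  - exact: mtrunc.
  - by move=> x _; exact: trunc1_le1.
  - by apply: L2_integrable => //; apply: L2D => //; exact: Lcoord.
have : {ae leb, forall x, forall i, B x ->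
    (g x ord0 i + h x ord0 i) * trunc 1 (w x) = 0} by exact: filter_forall.
apply: filterS => x gh Bx wx.
apply/rowP => i; rewrite mxE; have /eqP := gh i Bx.
by rewrite mulf_eq0 (gt_eqF (trunc_gt0 _ _))// orbF addr_eq0 => /eqP.
Qed.

Let pos x : R := (0 < w x)%R%:R.

Let mpos : measurable_fun B pos.
Proof.
rewrite (_ : pos = fun x => \1_(`]0, +oo[%classic : set R) (w x)).
  exact: (measurableT_comp (measurable_indic (measurable_itv _)) mw).
apply/funext => x; rewrite indicE; congr (_%:R); congr nat_of_bool.
by apply/idP/idP; rewrite inE /= in_itv/= andbT.
Qed.

Let H x := enorm (h x) * pos x.

Let H_ge0 x : 0 <= H x.
Proof. by rewrite mulr_ge0 ?enorm_ge0. Qed.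

Let LH : L2 leb B H.
Proof.
apply: (L2_le _ _ _ Lh) => //; first by apply: measurable_funM => //; case: Lh.
by move=> x _; rewrite normrM ler_piMr// /pos; case: ltP; rewrite ?normr0 ?normr1.
Qed.

Let pos_dtrunc e x : 0 < e -> dtrunc e (w x) = dtrunc e (w x) * pos x.
Proof.
move=> e0; rewrite /pos; have := w_ge0 x; rewrite le_eqVlt => /predU1P[<-|->].
  by rewrite dtrunc0 mul0r.
by rewrite mulr1.
Qed.

Let chi e k x := trunc e (psi k x).

Let tchi e k : 0 < e -> test_function B (chi e k).
Proof. by move=> e0; exact: test_function_trunc. Qed.

Let gradient_chi e k x i : 0 < e ->
  gradient (chi e k) x ord0 i = dtrunc e (psi k x) * partial i (psi k) x.
Proof.
by move=> e0; rewrite mxE partial_trunc//; exact: test_smooth (tpsi k).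
Qed.

Variable b : 'rV[R]_n -> 'rV[R]_n.
Hypothesis mb : measurable_fun B b.
Hypothesis Lb : L2 leb B (fun x => enorm (b x)).
Hypothesis supersolution : forall phi, test_function B phi ->
  (forall x, 0 <= phi x) ->
  0 <= \int[leb]_(x in B) dotv (g x) (gradient phi x)
     + \int[leb]_(x in B) (dotv (b x) (g x) * phi x).

Let mdotv (v v' : 'rV[R]_n -> 'rV[R]_n) : measurable_fun B v ->
  measurable_fun B v' -> measurable_fun B (fun x => dotv (v x) (v' x)).
Proof.
move=> mv mv'; apply: measurable_sum => i.
by apply: measurable_funM; exact: mcoord.
Qed.

Let energy_step e : 0 < e ->
  (\int[leb]_(x in B) (dtrunc e (w x) * enorm (h x) ^+ 2)%:E <=
   \int[leb]_(x in B) (n%:R * (enorm (b x) * H x * w x))%:E)%E.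
Proof.
move=> e0; have einv0 : 0 <= e^-1 by rewrite invr_ge0 ltW.
have dE k x : dotv (g x) (gradient (chi e k) x) =
    \sum_(i < n) g x ord0 i * (dtrunc e (psi k x) * partial i (psi k) x).
  by apply: eq_bigr => i _; rewrite gradient_chi.
have mX : measurable_fun B
    (fun x => \sum_(i < n) g x ord0 i * (dtrunc e (w x) * h x ord0 i)).
  apply: measurable_sum => i; apply: measurable_funM; first exact: mcoord.
  by apply: measurable_funM; [exact: mdtrunc|exact: mcoord].
have mY : measurable_fun B (fun x => dotv (b x) (g x) * trunc e (w x)).
  by apply: measurable_funM; [exact: mdotv|exact: mtrunc].
have [iX limX] : leb.-integrable B (EFin \o (fun x =>
      \sum_(i < n) g x ord0 i * (dtrunc e (w x) * h x ord0 i))) /\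
    (fun k => \int[leb]_(x in B) dotv (g x) (gradient (chi e k) x)) @ \oo -->
    \int[leb]_(x in B) (\sum_(i < n) g x ord0 i * (dtrunc e (w x) * h x ord0 i)).
  apply: (@real_dominated _ _ _ leb B mB _ _
    (fun x => n%:R * (enorm (g x) * E x))) => //.
  - move=> k; rewrite (_ : (fun x => _) = fun x => \sum_(i < n) g x ord0 i *
        (dtrunc e (psi k x) * partial i (psi k) x)); last first.
      by apply/funext => x; exact: dE.
    apply: measurable_sum => i; apply: measurable_funM; first exact: mcoord.
    by apply: measurable_funM; first exact: mdtrunc.
  - apply: filterS psi_cvg => x /[apply] -[pw dpw].
    rewrite (_ : (fun k => _) = fun k =>
      \sum_(i < n) g x ord0 i * (dtrunc e (psi k x) * partial i (psi k) x)).
      elim: (index_enum _) => [|i s IH].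
        by rewrite big_nil; under eq_fun do rewrite big_nil; exact: cvg_cst.
      rewrite big_cons; under eq_fun do rewrite big_cons.
      apply: cvgD => //; apply: cvgM; first exact: cvg_cst.
      by apply: cvgM; [exact: cvg_dtrunc_psi|exact: dpw].
    by apply/funext => k; exact: dE.
  - exact: (integrableZl mB n%:R (L2_integrableM mB Lg LE)).
  - apply: filterS dpsi_le => x dpx Bx k; rewrite dE.
    apply: le_trans (ler_norm_sum _ _ _) _.
    rewrite -[n in n%:R]card_ord mulr_natl -sumr_const; apply: ler_sum => i _.
    rewrite normrM ler_pM ?ler_coord_enorm// (normrM (dtrunc e _)).
    by rewrite -[leRHS]mul1r ler_pM ?dtrunc_le1//; exact: dpx.
have [iY limY] : leb.-integrable B (EFin \o (fun x =>
      dotv (b x) (g x) * trunc e (w x))) /\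
    (fun k => \int[leb]_(x in B) (dotv (b x) (g x) * chi e k x)) @ \oo -->
    \int[leb]_(x in B) (dotv (b x) (g x) * trunc e (w x)).
  apply: (@real_dominated _ _ _ leb B mB _ _
    (fun x => e^-1 * (n%:R * (enorm (b x) * enorm (g x))))) => //.
  - by move=> k; apply: measurable_funM; [exact: mdotv|exact: mtrunc].
  - apply: filterS psi_cvg => x /[apply] -[pw _].
    by apply: cvgM; [exact: cvg_cst|exact: cvg_trunc_psi].
  - have := integrableZl mB n%:R (L2_integrableM mB Lb Lg).
    exact: (integrableZl mB e^-1).
  - apply: nearW => x _ k; rewrite normrM mulrC ler_pM ?norm_dotv_le//.
    by rewrite ger0_norm ?trunc_ge0// trunc_le_inv.
have XY : 0 <= \int[leb]_(x in B) (\sum_(i < n) g x ord0 i *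
      (dtrunc e (w x) * h x ord0 i)) +
    \int[leb]_(x in B) (dotv (b x) (g x) * trunc e (w x)).
  apply: (cvgr_to_ge (cvgD limX limY)); apply: nearW => k /=.
  by apply: supersolution; [exact: tchi|move=> x; exact: trunc_ge0].
have XE : (\int[leb]_(x in B) (\sum_(i < n) g x ord0 i *
      (dtrunc e (w x) * h x ord0 i))%:E =
    - \int[leb]_(x in B) (dtrunc e (w x) * enorm (h x) ^+ 2)%:E)%E.
  rewrite -integral_ge0N; last first.
    by move=> x _; rewrite lee_fin mulr_ge0 ?sqr_ge0 ?dtrunc_ge0.
  apply: ae_eq_integral => //.
  - exact/measurable_EFinP.
  - apply/measurable_EFinP; apply: measurableT_comp => //.
    apply: measurable_funM; first exact: mdtrunc.
    by apply: measurable_funX; case: Lh.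
  - apply: filterS gradient_sign => x gh Bx /=; congr (_%:E).
    have [wx|wx] := eqVneq (w x) 0.
      by rewrite wx dtrunc0 !mul0r oppr0 big1// => i _; rewrite mul0r mulr0.
    rewrite sqr_enorm /dotv mulr_sumr -sumrN; apply: eq_bigr => i _.
    by rewrite (gh Bx wx) mxE; ring.
have AY : (\int[leb]_(x in B) (dtrunc e (w x) * enorm (h x) ^+ 2)%:E <=
    \int[leb]_(x in B) (dotv (b x) (g x) * trunc e (w x))%:E)%E.
  rewrite -[leLHS]oppeK -XE.
  rewrite -(fineK (integrable_fin_num mB iX)) -(fineK (integrable_fin_num mB iY)).
  by rewrite -EFinN lee_fin -subr_ge0 opprK addrC.
apply: le_trans AY _.
apply: le_trans (le_trans (lee_abs _) (le_abse_integral _ mB _)) _.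
  exact/measurable_EFinP.
have mR : measurable_fun B (fun x => n%:R * (enorm (b x) * H x * w x)).
  apply: measurable_funM => //; apply: measurable_funM => //.
  by apply: measurable_funM; [case: Lb|case: LH].
apply: ae_ge0_le_integral => //.
- by apply: measurableT_comp => //; exact/measurable_EFinP.
- by move=> x _; rewrite lee_fin !mulr_ge0 ?enorm_ge0.
- exact/measurable_EFinP.
apply: filterS gradient_sign => x gh Bx /=; rewrite lee_fin normrM.
have [wx|wx] := eqVneq (w x) 0; first by rewrite wx trunc0// normr0 !mulr0.
have wp : 0 < w x by rewrite lt_neqAle eq_sym wx w_ge0.
rewrite mulrA ler_pM//; last first.
  rewrite ger0_norm ?trunc_ge0//; apply: le_trans (trunc_le _ e0) _.
  by rewrite ger0_norm.
apply: le_trans (norm_dotv_le _ _) _; rewrite /H /pos wp mulr1 (gh Bx wx).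
rewrite (_ : enorm (- h x) = enorm (h x))// /enorm /dotv.
by congr Num.sqrt; apply: eq_bigr => i _; rewrite mxE mulrNN.
Qed.

Lemma energy_estimate :
  (\int[leb]_(x in B) (H x ^+ 2)%:E <=
   \int[leb]_(x in B) (n%:R * (enorm (b x) * H x * w x))%:E)%E.
Proof.
have e0 (k : nat) : 0 < k.+1%:R^-1 :> R by rewrite invr_gt0.
apply: (@fatou_le _ _ _ leb B
  (fun k x => dtrunc k.+1%:R^-1 (w x) * enorm (h x) ^+ 2)) => //.
- move=> k; apply: measurable_funM; first exact: mdtrunc.
  by apply: measurable_funX; case: Lh.
- by move=> k x _; rewrite mulr_ge0 ?sqr_ge0 ?dtrunc_ge0.
- move=> x _; rewrite /H /pos; have := w_ge0 x; rewrite le_eqVlt => /predU1P[wx|wx].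
    rewrite -wx ltxx mulr0 expr0n/=.
    rewrite (_ : (fun k => _) = fun=> 0); first exact: cvg_cst.
    by apply/funext => k; rewrite dtrunc0 mul0r.
  rewrite wx mulr1 -[X in _ --> X]mul1r; apply: cvgM; last exact: cvg_cst.
  exact: cvg_dtrunc.
- by move=> k; exact: energy_step.
Qed.

Hypothesis n3 : (3 <= n)%N.

Let N : R := n%:R.
Let q : R := 2 * N / (N - 2).
Let C : R := 2 * (N - 1) / (N - 2).

Let N3 : 3 <= N. Proof. by rewrite (ler_nat _ 3). Qed.
Let N2_gt0 : 0 < N - 2. Proof. by have := N3; lra. Qed.
Let N_gt0 : 0 < N. Proof. by have := N3; lra. Qed.
Let q_gt0 : 0 < q. Proof. by rewrite !mulr_gt0// invr_gt0. Qed.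
Let C_gt0 : 0 < C. Proof. by rewrite !mulr_gt0 ?invr_gt0//; have := N3; lra. Qed.

Let integral_support (f : 'rV[R]_n -> \bar R) : (forall x, ~ B x -> f x = 0%E) ->
  (\int[leb]_x f x = \int[leb]_(x in B) f x)%E.
Proof.
move=> f0; rewrite [RHS]integral_mkcond; apply: eq_integral => x _.
by rewrite /patch; case: ifPn => //; rewrite notin_setE => /f0.
Qed.

Let sobolev_trunc e : 0 < e ->
  (\int[leb]_(x in B) (trunc e (w x) `^ q)%:E <=
   ((C ^+ 2)%:E * \int[leb]_(x in B) (H x ^+ 2)%:E) `^ (N / (N - 2)))%E.
Proof.
move=> e0; have einv0 : 0 <= e^-1 by rewrite invr_ge0 ltW.
pose G k x := \sum_(i < n) (dtrunc e (psi k x) * partial i (psi k) x) ^+ 2.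
have GE k x : enorm (gradient (chi e k) x) ^+ 2 = G k x.
  rewrite sqr_enorm; apply: eq_bigr => i _.
  by rewrite gradient_chi// expr2.
have mpow (f : 'rV[R]_n -> R) : measurable_fun B f ->
    measurable_fun B (fun x => trunc e (f x) `^ q).
  by move=> mf; apply: (measurableT_comp (measurable_powR _)); exact: mtrunc.
have bpow t : `|trunc e t `^ q| <= e^-1 `^ q.
  rewrite ger0_norm ?powR_ge0// ge0_ler_powR ?nnegrE ?trunc_ge0 ?trunc_le_inv//.
  exact: ltW.
have ibound : leb.-integrable B (EFin \o (fun=> e^-1 `^ q)).
  by apply: L2_integrable => //; exact: L2_cst.
have mG k : measurable_fun B (G k).
  apply: measurable_sum => i; apply: measurable_funX.
  by apply: measurable_funM; first exact: mdtrunc.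
have mGw : measurable_fun B
    (fun x => \sum_(i < n) (dtrunc e (w x) * h x ord0 i) ^+ 2).
  apply: measurable_sum => i; apply: measurable_funX.
  by apply: measurable_funM; [exact: mdtrunc|exact: mcoord].
have [iX limX] : leb.-integrable B (EFin \o (fun x => trunc e (w x) `^ q)) /\
    (fun k => \int[leb]_(x in B) (chi e k x `^ q)) @ \oo -->
    \int[leb]_(x in B) (trunc e (w x) `^ q).
  apply: (@real_dominated _ _ _ leb B mB _ _ (fun=> e^-1 `^ q)) => //.
  - by move=> k; exact: mpow.
  - exact: mpow.
  - apply: filterS psi_cvg => x /[apply] -[pw _].
    apply: cvg_powR => //; [by move=> k; exact: trunc_ge0|exact: trunc_ge0|].
    exact: cvg_trunc_psi.
  - by apply: nearW => x _ k; exact: bpow.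
have Gle x k : (forall i, `|partial i (psi k) x| <= E x) -> `|G k x| <= N * (E x * E x).
  move=> dpx; apply: le_trans (ler_norm_sum _ _ _) _.
  rewrite /N -[n in n%:R]card_ord mulr_natl -sumr_const; apply: ler_sum => i _.
  rewrite normrX expr2 ler_pM// (normrM (dtrunc e _));
    by rewrite -[leRHS]mul1r ler_pM ?dtrunc_le1.
have iNEE := integrableZl mB N (L2_integrableM mB LE LE).
have [iY limY] : leb.-integrable B (EFin \o (fun x =>
      \sum_(i < n) (dtrunc e (w x) * h x ord0 i) ^+ 2)) /\
    (fun k => \int[leb]_(x in B) G k x) @ \oo -->
    \int[leb]_(x in B) (\sum_(i < n) (dtrunc e (w x) * h x ord0 i) ^+ 2).
  apply: (@real_dominated _ _ _ leb B mB _ _ (fun x => N * (E x * E x))) => //.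
  - apply: filterS psi_cvg => x /[apply] -[pw dpw].
    rewrite /G; elim: (index_enum _) => [|i s IH].
      by rewrite big_nil; under eq_fun do rewrite big_nil; exact: cvg_cst.
    rewrite big_cons; under eq_fun do rewrite big_cons.
    apply: cvgD => //.
    have c1 : (fun k => dtrunc e (psi k x) * partial i (psi k) x) @ \oo -->
        dtrunc e (w x) * h x ord0 i.
      by apply: cvgM; [exact: cvg_dtrunc_psi|exact: dpw].
    exact: (cvgM c1 c1).
  - by apply: filterS dpsi_le => x dpx Bx k; apply: Gle => i; exact: dpx.
have step k : (\int[leb]_(x in B) (chi e k x `^ q)) `^ ((N - 2) / N) <=
    C ^+ 2 * \int[leb]_(x in B) G k x.
  have sob := sobolev n3 (tchi k e0) (fun x => trunc_ge0 _ e0).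
  have iXk : leb.-integrable B (EFin \o (fun x => chi e k x `^ q)).
    apply: (le_integrable mB _ _ ibound).
      by apply/measurable_EFinP; exact: mpow.
    move=> x _ /=; rewrite lee_fin; apply: le_trans (bpow _) (ler_norm _).
  have iYk : leb.-integrable B (EFin \o G k).
    rewrite (_ : G k = fun x => \sum_(i < n) (partial i (chi e k) x * partial i (chi e k) x)).
      rewrite (_ : EFin \o _ = fun x => (\sum_(i < n)
        (EFin \o (fun x => partial i (chi e k) x * partial i (chi e k) x)%R) x)%E); last first.
        by apply/funext => x /=; rewrite sumEFin.
      apply: integrable_sum => // i _; apply: integrable_mul_test.
        have td := test_function_partial i (tchi k e0).
        have [M _ tM] := test_function_bounded td.
        apply: (L2_le mB _ _ (L2_cst mB M B_lty)).
          by apply: measurable_funTS; exact: measurable_smooth (test_smooth td).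
        by move=> x _; apply: le_trans (tM x) (ler_norm _).
      exact: test_function_partial (tchi k e0).
    apply/funext => x; rewrite -GE sqr_enorm; apply: eq_bigr => i _.
    by rewrite mxE.
  rewrite (integral_support (f := fun x => (trunc e (psi k x) `^ _)%:E)) in sob; last first.
    move=> x nB; have := test_function_eq0 (tchi k e0) nB; rewrite /chi => ->.
    by rewrite powR0// gt_eqF.
  rewrite (integral_support (f := fun x => (enorm (gradient _ x) ^+ 2)%:E)) in sob; last first.
    move=> x nB; rewrite GE /G big1// => i _.
    have := test_function_eq0 (test_function_partial i (tchi k e0)) nB.
    by rewrite (partial_trunc _ _ e0 (test_smooth (tpsi k))) => ->; rewrite expr0n.
  rewrite -lee_fin EFinM -poweR_EFin /Rintegral.
  rewrite !fineK; [|exact: integrable_fin_num iYk|exact: integrable_fin_num iXk].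
  apply: le_trans sob _; rewrite le_eqVlt; apply/orP; left; apply/eqP.
  by congr (_ * _)%E; apply: eq_integral => x _; rewrite GE.
have c0 : 0 < (N - 2) / N by rewrite divr_gt0.
have X0 k : 0 <= \int[leb]_(x in B) (chi e k x `^ q).
  by apply: Rintegral_ge0 => // x _; exact: powR_ge0.
have Xw0 : 0 <= \int[leb]_(x in B) (trunc e (w x) `^ q).
  by apply: Rintegral_ge0 => // x _; exact: powR_ge0.
have lim_ineq : (\int[leb]_(x in B) (trunc e (w x) `^ q)) `^ ((N - 2) / N) <=
    C ^+ 2 * \int[leb]_(x in B) (\sum_(i < n) (dtrunc e (w x) * h x ord0 i) ^+ 2).
  have l1 := cvg_powR _ c0 X0 Xw0 limX.
  have l2 := cvgM (cvg_cst (C ^+ 2)) limY.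
  rewrite -subr_ge0. apply: (cvgr_to_ge (cvgB (l2 _ _) (l1 _))); apply: nearW => k /=.
  by rewrite subr_ge0; exact: step.
have -> : (\int[leb]_(x in B) (trunc e (w x) `^ q)%:E =
    (\int[leb]_(x in B) (trunc e (w x) `^ q))%:E)%E.
  by rewrite /Rintegral fineK//; exact: integrable_fin_num iX.
have r0 : 0 <= N / (N - 2) by rewrite divr_ge0 ?ltW.
set y := \int[leb]_(x in B) (\sum_(i < n) _) in lim_ineq.
have y0 : 0 <= y.
  by apply: Rintegral_ge0 => // x _; apply: sumr_ge0 => i _; exact: sqr_ge0.
have yH : (y%:E <= \int[leb]_(x in B) (H x ^+ 2)%:E)%E.
  rewrite /y /Rintegral fineK; last exact: integrable_fin_num iY.
  apply: ge0_le_integral => //.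
  - by move=> x _; rewrite lee_fin; apply: sumr_ge0 => i _; exact: sqr_ge0.
  - exact/measurable_EFinP.
  - by apply/measurable_EFinP; apply: measurable_funX; case: LH.
  move=> x _; rewrite lee_fin.
  have := dtrunc_le1 (w x) e0; have := pos_dtrunc x e0.
  move: (dtrunc e (w x)) => D Dpos D1.
  under eq_bigr do rewrite exprMn.
  rewrite -mulr_sumr (_ : \sum_(i < n) _ = enorm (h x) ^+ 2); last first.
    by rewrite sqr_enorm; apply: eq_bigr => i _; rewrite expr2.
  rewrite Dpos /H !exprMn [leRHS]mulrC -mulrA.
  apply: ler_piMl; first by rewrite mulr_ge0 ?sqr_ge0.
  by rewrite -real_normK ?num_real// -[leRHS](expr1n _ 2) ler_pXn2r ?nnegrE.
apply: (@le_trans _ _ (((C ^+ 2)%:E * y%:E) `^ (N / (N - 2)))%E).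
  rewrite -EFinM poweR_EFin lee_fin.
  have rV : (N - 2) / N * (N / (N - 2)) = 1 by field; rewrite !gt_eqF.
  rewrite -[leLHS](powRr1 Xw0) -[in leLHS]rV powRrM; apply: ge0_ler_powR => //.
  - by rewrite nnegrE powR_ge0.
  - by rewrite nnegrE mulr_ge0 ?sqr_ge0.
apply: gt0_ler_poweR => //.
- by rewrite in_itv/= leey andbT mule_ge0 ?lee_fin ?sqr_ge0.
- rewrite in_itv/= leey andbT mule_ge0 ?lee_fin ?sqr_ge0//.
  by apply: integral_ge0 => x _; rewrite lee_fin sqr_ge0.
- by apply: lee_wpmul2l => //; rewrite lee_fin sqr_ge0.
Qed.

Lemma sobolev_negative_part :
  (\int[leb]_(x in B) (w x `^ q)%:E <=
   ((C ^+ 2)%:E * \int[leb]_(x in B) (H x ^+ 2)%:E) `^ (N / (N - 2)))%E.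
Proof.
have e0 (k : nat) : 0 < k.+1%:R^-1 :> R by rewrite invr_gt0.
apply: (@fatou_le _ _ _ leb B (fun k x => trunc k.+1%:R^-1 (w x) `^ q)) => //.
- move=> k; apply: (measurableT_comp (measurable_powR _)); exact: mtrunc.
- by move=> k x _; exact: powR_ge0.
- move=> x _; rewrite -[in X in _ --> X](ger0_norm (w_ge0 x)).
  apply: cvg_powR => //; first by move=> k; exact: trunc_ge0.
  exact: cvg_trunc.
- by move=> k; exact: sobolev_trunc.
Qed.

Lemma supersolution_nonneg (k : R) :
  leb.-integrable B (EFin \o (fun x => enorm (b x) `^ N)) ->
  ((\int[leb]_(x in B) (enorm (b x) `^ N)%:E) `^ N^-1 <= k%:E)%E ->
  N * k * C < 1 ->
  {ae leb, forall x, B x -> 0 <= u x}.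
Proof.
move=> iB bk kC.
have k0 : 0 <= k by rewrite -lee_fin; apply: le_trans bk; exact: poweR_ge0.
have mH : measurable_fun B H by case: LH.
have mbn : measurable_fun B (fun x => enorm (b x)) by case: Lb.
set A := (\int[leb]_(x in B) (H x ^+ 2)%:E)%E.
have A0 : (0 <= A)%E by apply: integral_ge0 => x _; rewrite lee_fin sqr_ge0.
have Afin : A \is a fin_num by apply: integrable_fin_num => //; case: LH.
set W := (\int[leb]_(x in B) (w x `^ q)%:E)%E.
have W0 : (0 <= W)%E by apply: integral_ge0 => x _; rewrite lee_fin powR_ge0.
have WA : (W <= ((C ^+ 2)%:E * A) `^ (N / (N - 2)))%E.
  exact: sobolev_negative_part.
pose f (j : option bool) x :=
  if j is Some c then if c then H x ^+ 2 else w x `^ q else enorm (b x) `^ N.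
pose p (j : option bool) : R :=
  if j is Some c then if c then 2^-1 else q^-1 else N^-1.
have qV : q^-1 = (N - 2) / (2 * N) by rewrite /q invf_div.
have holder : (\int[leb]_(x in B) (enorm (b x) * H x * w x)%:E <=
    (\int[leb]_(x in B) (enorm (b x) `^ N)%:E) `^ N^-1 * (A `^ 2^-1 * W `^ q^-1))%E.
  have := @hoelder_prod_on _ _ R leb B mB _ [:: None; Some true; Some false] p f.
  rewrite !big_cons !big_nil mule1.
  rewrite (eq_integral (fun x => (enorm (b x) * H x * w x)%:E)); last first.
    move=> x _; rewrite !big_cons big_nil mulr1 /=; congr (_%:E).
    rewrite -!powRrM !mulfV ?gt_eqF// !powRr1 ?enorm_ge0 ?w_ge0//.
    by rewrite powR12_sqrt ?sqr_ge0// sqrtr_sqr ger0_norm// mulrA.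
  apply.
  - by case=> [[]|]; rewrite /p invr_gt0.
  - rewrite addr0 /p qV; field; rewrite gt_eqF//.
  - case=> [[]|] /=; first exact: measurable_funX.
      exact: (measurableT_comp (measurable_powR _)).
    exact: (measurableT_comp (measurable_powR _)).
  - by case=> [[]|] x /=; rewrite ?sqr_ge0 ?powR_ge0.
have WA' : (W `^ q^-1 <= C%:E * A `^ 2^-1)%E.
  have -> : (C%:E * A `^ 2^-1 = (((C ^+ 2)%:E * A) `^ (N / (N - 2))) `^ q^-1)%E.
    rewrite -poweRrM (_ : N / (N - 2) * q^-1 = 2^-1); last first.
      by rewrite qV; field; rewrite !gt_eqF.
    rewrite poweRM ?lee_fin ?sqr_ge0// poweR_EFin powR12_sqrt ?sqr_ge0//.
    by rewrite sqrtr_sqr gtr0_norm.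
  apply: gt0_ler_poweR => //; first by rewrite invr_ge0 ltW.
  - by rewrite in_itv/= leey andbT.
  - by rewrite in_itv/= leey andbT poweR_ge0.
have AA : (A <= (N * k * C)%:E * A)%E.
  apply: le_trans energy_estimate _.
  under eq_integral do rewrite EFinM.
  rewrite ge0_integralZl//; first last.
  - by move=> x _; rewrite lee_fin !mulr_ge0 ?enorm_ge0.
  - apply/measurable_EFinP; apply: measurable_funM => //.
    exact: measurable_funM.
  apply: (@le_trans _ _ (N%:E * (k%:E * (A `^ 2^-1 * (C%:E * A `^ 2^-1)))))%E.
    apply: lee_wpmul2l; first by rewrite lee_fin ltW.
    apply: le_trans holder _; apply: lee_pmul => //.
    + exact: poweR_ge0.
    + by rewrite mule_ge0 ?poweR_ge0.
    + by apply: lee_wpmul2l => //; exact: poweR_ge0.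
  have AE : (A `^ 2^-1 * A `^ 2^-1 = A)%E.
    rewrite -poweRD_ge0// (_ : (2^-1 + 2^-1 = 1 :> R)%R) ?poweRe1//; lra.
  rewrite muleCA (muleCA (A `^ _)%E) AE !muleA -!EFinM.
  by rewrite (mulrC k).
have Az : A = 0%E.
  move: AA A0; rewrite -(fineK Afin) -EFinM !lee_fin => AA A0.
  congr (_%:E); apply/eqP; rewrite eq_le A0 andbT.
  rewrite leNgt; apply/negP => a0; move: AA; rewrite leNgt => /negP; apply.
  by rewrite gtr_pMl.
have Wz : W = 0%E.
  apply/eqP; rewrite eq_le W0 andbT; apply: le_trans WA _.
  by rewrite Az mule0 poweR0r// gt_eqF// divr_gt0.
have /ae_eq_integral_abs : (\int[leb]_(x in B) `|(w x `^ q)%:E| = 0)%E.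
  by rewrite -[RHS]Wz; apply: eq_integral => x _; rewrite gee0_abs// lee_fin powR_ge0.
move=> /(_ mB); have mwq : measurable_fun B (fun x => (w x `^ q)%:E).
  by apply/measurable_EFinP; exact: (measurableT_comp (measurable_powR _)).
move=> /(_ mwq); apply: filterS => x /[apply] /= -[] /powR_eq0_eq0 /eqP.
rewrite /w oppr_eq0 minEle; case: ifP => [_ /eqP -> //|/negbT].
by rewrite -ltNge => /ltW.
Qed.

End negative_part.

Theorem theorem1p4 (R : realType) (n : nat) (hn : (3 <= n)%N) :
  exists k : R, 0 < k /\
    forall (b : 'rV[R]_n -> 'rV[R]_n) (u : 'rV[R]_n -> R),
      in_Lp_vec (unit_ball R n) n%:R b ->
      in_H1 (unit_ball R n) u ->
      weak_supersolution (unit_ball R n) b u ->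
      boundary_nonneg (unit_ball R n) u ->
      (Lp_norm (unit_ball R n) n%:R (enorm \o b) <= k%:E)%E ->
      {ae @lebesgue_rV R n, forall x, unit_ball R n x -> 0 <= u x}.
Proof.
have N3 : 3 <= n%:R :> R by rewrite (ler_nat _ 3).
set N : R := n%:R in N3 *.
have N0 : 0 < N by lra.
pose C : R := 2 * (N - 1) / (N - 2).
have N1 : 0 < N - 1 by lra.
have N2 : 0 < N - 2 by lra.
have C0 : 0 < C by exact: divr_gt0 (mulr_gt0 (ltr0Sn _ 1) N1) N2.
exists (2 * N * C)^-1; split.
  by rewrite invr_gt0; exact: mulr_gt0 (mulr_gt0 (ltr0Sn _ 1) N0) C0.
move=> b u Lb [Lu wgu] super [[Lw wgw] [phi [tphi phiw dphiw]]] bk.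
set B := unit_ball R n in Lb Lu wgu super Lw wgw tphi phiw dphiw bk *.
have [[Lg wg_u] [Lh wg_w]] := (getPex wgu, getPex wgw).
rewrite -/(weak_gradient B u) in Lg wg_u.
set w := fun x => - Num.min (u x) 0 in Lw wgw phiw dphiw Lh wg_w.
rewrite -/(weak_gradient B w) in Lh wg_w.
have mB : measurable B := unit_ball_measurable.
have [psi [S [tpsi [mS iS S0] dpsi_le psi_cvg]]] :=
  test_approximation mB (proj1 Lw) (proj1 Lh) tphi phiw dphiw.
have LbN := Lp_vec_powR_integrable N0 Lb.
have L2b : L2 (@lebesgue_rV R n) B (fun x => enorm (b x)).
  have mb : measurable_fun B (fun x => enorm (b x)).
    by apply: measurable_enorm_comp => i; apply: measurable_coord_comp; case: Lb.
  split => //.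
  have [_ i1] := L2_cst mB 1 (lebesgue_unit_ball_lty n).
  have := integrableD mB i1 LbN; apply: le_integrable => //.
    by apply/measurable_EFinP; exact: measurable_funX.
  move=> x _ /=; rewrite lee_fin expr1n (ger0_norm (sqr_ge0 _)).
  rewrite ger0_norm ?addr_ge0 ?powR_ge0//.
  have [b1|b1] := leP (enorm (b x)) 1.
    have b2 : enorm (b x) ^+ 2 <= 1 by rewrite exprn_ile1 ?enorm_ge0.
    by apply: le_trans b2 _; rewrite lerDl powR_ge0.
  rewrite -powR_mulrn ?enorm_ge0// ler_wpDl// ler_powR ?(ltW b1)//.
  by lra.
have bN : ((\int[@lebesgue_rV R n]_(x in B) (enorm (b x) `^ N)%:E) `^ N^-1 <=
    ((2 * N * C)^-1)%:E)%E.
  have <- : (\int[@lebesgue_rV R n]_(x in B) (`|(enorm \o b) x| `^ N)%:E =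
      \int[@lebesgue_rV R n]_(x in B) (enorm (b x) `^ N)%:E)%E.
    by apply: eq_integral => x _ /=; rewrite ger0_norm ?enorm_ge0.
  rewrite -Lp_norm_powR ?gt_eqF// -poweRrM mulfV ?gt_eqF// poweRe1//.
  exact: Lnorm_ge0.
have kC : N * (2 * N * C)^-1 * C < 1.
  rewrite (_ : _ * C = 2^-1); first by lra.
  by field; rewrite !gt_eqF.
exact: (supersolution_nonneg (Lp2_L2 Lu) (proj1 Lg) (Lp_vec2_L2 Lg) (proj1 Lh)
  (Lp_vec2_L2 Lh) wg_u wg_w tpsi mS iS S0 dpsi_le psi_cvg (proj1 Lb) L2b
  super hn LbN bN kC).
Qed.
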